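(* Let $Z:\mathcal P\to\mathbb R$ be $\mathcal C^2$, with $Z$ $L_0$-Lipschitz, $\nabla Z$ $L_1$-Lipschitz and $\nabla^2Z$ $L_2$-Lipschitz on $\mathcal P$ (all with respect to $\|\cdot\|$), and for each $\mathbf q\in\mathcal P$ let the noisy evaluation $\hat Z(\mathbf q)$ satisfy $E[\hat Z(\mathbf q)]=Z(\mathbf q)$ and $\mathrm{Var}[\hat Z(\mathbf q)]\le\sigma^2$, with $\sigma^2>0$ a constant. Let $\mathbf p\in\mathcal P$, $c\in(0,1]$, $R\ge 1$, let $\boldsymbol\delta$ be a random vector in $\mathcal P$ and let $S(\mathbf p,\boldsymbol\delta)=\gamma(\boldsymbol\delta-\mathbf p)$ with $\gamma\in\mathbb R$, chosen such that $$\text{(MC1)}\quad E[S(\mathbf p,\boldsymbol\delta)]=\mathbf 0,\qquad \text{(MC2)}\quad E[(\boldsymbol\delta-\mathbf p)S(\mathbf p,\boldsymbol\delta)']=\mathbf I-\lambda\mathbf 1\mathbf 1'\ \text{ for some }\lambda\in\mathbb R.$$ Let $\hat\psi_{FFE}=\frac1R\sum_{j=1}^R\frac{\hat Z^{2j-1}((1-c)\mathbf p+c\boldsymbol\delta^j)-\hat Z^{2j}(\mathbf p)}{c}S(\mathbf p,\boldsymbol\delta^j)$ and $\psi_{FFE}=E[\hat\psi_{FFE}]$. Then $$\psi_{FFE}-\nabla Z(\mathbf p)-\epsilon_0\mathbf 1=\boldsymbol\epsilon,\qquad \epsilon_0=-\frac{\nabla Z(\mathbf p)'\mathbf 1}{n},\qquad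 \|\boldsymbol\epsilon\|=O(ncM_2+nc^2L_2),$$ and $$E[\|\hat\psi_{FFE}-\psi_{FFE}\|^2]=O\Big(\frac{\gamma n}{Rc^2}\,[\sigma^2+c^2M_1^2+c^4L_1^2]\Big).$$ Moreover, if in addition (MC3) holds, i.e. there is $\mu\in\mathbb R$ with $E[(\boldsymbol\delta-\mathbf p)_i(\boldsymbol\delta-\mathbf p)_jS(\mathbf p,\boldsymbol\delta)_k]=\mu$ for all $i,j,k\in\{1,\dots,n\}$, then $$\psi_{FFE}-\nabla Z(\mathbf p)-\epsilon_0\mathbf 1=\boldsymbol\epsilon,\qquad \epsilon_0=\frac{c\mu}{2}\mathbf 1'\nabla^2Z(\mathbf p)\mathbf 1-\frac{\nabla Z(\mathbf p)'\mathbf 1}{n},\qquad \|\boldsymbol\epsilon\|=O(nc^2L_2).$$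
   Context: $n\ge2$; $\mathcal P=\{\mathbf p\in\mathbb R^n: \sum_i p_i=1,\ p_i\ge 0\}$ is the probability simplex. $\|\cdot\|$ is the Euclidean norm of vectors and the spectral norm of matrices, $\mathbf 1$ is the all-ones vector, $\mathbf I$ the identity matrix, $\mathbf e_i$ the $i$-th standard basis vector, and $'$ denotes transpose. Derivatives on the simplex. A function $F:\mathcal P\to\mathbb R$ is differentiable at $\mathbf p$ if there is a vector $\nabla F(\mathbf p)$ with $F(\mathbf q)-F(\mathbf p)=\nabla F(\mathbf p)'(\mathbf q-\mathbf p)+o(\|\mathbf q-\mathbf p\|)$ for $\mathbf q\in\mathcal P$; such a vector is unique only up to adding multiples of $\mathbf 1$, and $\nabla F(\mathbf p)=(F_1(\mathbf p),\dots,F_n(\mathbf p))'$ always denotes the version $F_i(\mathbf p)=\lim_{\epsilon\to0_+}\frac{F((1-\epsilon)\mathbf p+\epsilon\mathbf e_i)-F(\mathbf p)}{\epsilon}$. Higher derivatives are defined recursively by $F_{i_1,\dots,i_{k+1}}=(F_{i_1,\dots,i_k})_{i_{k+1}}$, and $\nabla^2F(\mathbf p)=(F_{i,j}(\mathbf p))_{i,j}$. $F$ is $\mathcal C^k$ if its derivatives of order up to $k$ exist in this sense and are continuous on $\mathcal P$. Set $M_0=\sup_{\mathcal P}|Z|$, $M_1=\sup_{\mathcal P}\|\nabla Z\|$, $M_2=\sup_{\mathcal P}\|\nabla^2Z\|$, which are finite. $\boldsymbol\delta^1,\dots,\boldsymbol\delta^R$ are i.i.d. copies of $\boldsymbol\delta$,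 and $\hat Z^1(\cdot),\hat Z^2(\cdot),\dots$ are mutually independent function evaluations, independent of the $\boldsymbol\delta^j$. $O(X)$ means bounded by an absolute constant times $X$ (independent of $n,c,R,\gamma,\mathbf p,Z$, the noise and the law of $\boldsymbol\delta$). *)

(* Defs.v *)
(* MathComp-Analysis. *)
From HB Require Import structures.
From mathcomp Require Import all_boot all_order all_algebra.
From mathcomp Require Import all_classical all_reals all_analysis.
Set Implicit Arguments.
Unset Strict Implicit.
Unset Printing Implicit Defensive.
Import Order.TTheory GRing.Theory Num.Theory.
Import numFieldNormedType.Exports.
Local Open Scope classical_set_scope.
Local Open Scope ring_scope.

Section Euclidean.
Context {R : realType}.

Definition simplex (n : nat) : set 'cV[R]_n :=
  [set p | \sum_i p i 0 = 1 /\ forall i, 0 <= p i 0].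

Definition dot (n : nat) (u v : 'cV[R]_n) : R := (u^T *m v) 0 0.

(* The library norm on matrices is the sup norm, hence these two. *)
Definition enorm (n : nat) (v : 'cV[R]_n) : R := Num.sqrt (dot v v).

Definition specnorm (n : nat) (A : 'M[R]_n) : R :=
  sup [set enorm (A *m x) | x in [set x : 'cV[R]_n | enorm x <= 1]].

Definition ones (n : nat) : 'cV[R]_n := const_mx 1.

End Euclidean.

Arguments simplex {R} n.
Arguments ones {R} n.

Section SimplexCalculus.
Context {R : realType} {n : nat}.
Implicit Types (F : 'cV[R]_n -> R) (p : 'cV[R]_n).

(* Functions on the simplex are total functions of which only the values on
   the simplex matter: every notion below looks at F on the simplex only. *)

Definition sdifferentiable F p : Prop :=
  let near_p := within (simplex n) (nbhs p) in
  exists g : 'cV[R]_n,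
    (fun q => F q - F p - dot g (q - p)) =o_near_p (fun q => enorm (q - p)).

Definition spartial (i : 'I_n) F p : R :=
  lim ((F ((1 - e) *: p + e *: delta_mx i 0) - F p) / e @[e --> 0^'+]).

Definition sgrad F p : 'cV[R]_n := \col_i spartial i F p.

Definition shess F p : 'M[R]_n := \matrix_(i, j) spartial j (spartial i F) p.

Fixpoint sC (k : nat) F : Prop :=
  {within simplex n, continuous F} /\
  if k is k'.+1 then
    (forall p, simplex n p -> sdifferentiable F p) /\
    (forall i, sC k' (spartial i F))
  else True.

End SimplexCalculus.

Section Probability.
Context {R : realType}.

(* R^n with its Borel sigma-algebra. *)
Definition borel_cV (n : nat) := g_sigma_algebraType (@open 'cV[R]_n).

Context {d : measure_display} {Omega : measurableType d}.
Variable P : probability Omega R.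

(* E[X] = A, entrywise.  As A is real, the expectations are finite; for a
   measurable X this includes integrability. *)
Definition has_mean (m n : nat) (X : Omega -> 'M[R]_(m, n)) (A : 'M[R]_(m, n)) :=
  forall i j, ('E_P[fun w => X w i j] = (A i j)%:E)%E.

Definition sigma_of (d' : measure_display) (T : measurableType d')
    (X : Omega -> T) : set (set Omega) :=
  preimage_set_system setT X measurable.

Definition mutually_independent (I : eqType) (E : I -> set (set Omega)) :=
  forall (s : seq I) (A : I -> set Omega), uniq s ->
    (forall i, i \in s -> E i (A i)) ->
    P (\bigcap_(i in [set` s]) A i) = (\prod_(i <- s) P (A i))%E.

Definition identically_distributed (d' : measure_display)
    (T : measurableType d') (X Y : Omega -> T) :=
  forall A : set T, measurable A -> P (X @^-1` A) = P (Y @^-1` A).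

(* A random function evaluation is q |-> zeta q xi for a noise element xi.
   Joint measurability makes its value at a random point a random variable,
   and independence of a point from the evaluation means independence from xi.
   (Independence from the evaluations at fixed points alone would not determine
   the law of the evaluation at a random point.) *)
Definition noisy_evaluation (n : nat) (Z : 'cV[R]_n -> R) (sigma : R)
    (d' : measure_display) (T : measurableType d')
    (zeta : 'cV[R]_n -> T -> R) (xi : Omega -> T) : Prop :=
  [/\ measurable_fun setT xi,
      measurable_fun (simplex n `*` setT : set (borel_cV n * T)%type)
        (fun x : (borel_cV n * T)%type => zeta x.1 x.2),
      (forall q, simplex n q -> 'E_P[fun w => zeta q (xi w)] = (Z q)%:E)%E
    & (forall q, simplex n q ->
         'V_P[fun w => zeta q (xi w)] <= (sigma ^+ 2)%:E)%E].

End Probability.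

Arguments borel_cV R n : clear implicits.

Section Estimator.
Context {R : realType} {n : nat}.

Definition Sffe (gamma : R) (p delta : 'cV[R]_n) : 'cV[R]_n :=
  gamma *: (delta - p).

(* Noisy evaluations are numbered from 0 and replications too, so that the
   pair (2j-1, 2j) of the j-th replication, j = 1..N, becomes (2j, 2j+1),
   j = 0..N-1. *)
Definition psi_hat (Omega : Type) (N : nat) (c gamma : R) (p : 'cV[R]_n)
    (Zhat : nat -> 'cV[R]_n -> Omega -> R) (delta : 'I_N -> Omega -> 'cV[R]_n)
    (w : Omega) : 'cV[R]_n :=
  N%:R^-1 *: \sum_(j < N)
    ((Zhat j.*2 ((1 - c) *: p + c *: delta j w) w - Zhat j.*2.+1 p w) / c)
      *: Sffe gamma p (delta j w).

End Estimator.

(* Main.v *)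
(** Along a segment [p + t h], [h = delta - p], the map [t |-> Z (p + t h)] has
    derivatives [dot (sgrad Z _) h] and [dot h (shess Z _ *m h)], because the
    coordinates of [h] sum to [0].  Multiplying its Taylor expansion by
    [S = gamma h] and taking expectations, (MC2) turns the linear term into
    [sgrad Z p] minus its mean, (MC3) turns the quadratic term into a multiple of
    the all-ones vector, and the remainders are controlled by
    [E[gamma |h|^2] = n - 1], the trace of (MC2) with [lambda = 1 / n].

    For the variance, one replication is a function of [delta_j] plus two noise
    terms that have mean zero given [delta_j] (Fubini for independent
    variables); replications are pairwise independent, so the cross terms of the
    squared average vanish. *)

Require Import Defs.
From HB Require Import structures.
From mathcomp Require Import all_boot all_order all_algebra.
From mathcomp Require Import all_classical all_reals all_analysis.
From mathcomp Require Import measurable_realfun ring lra zify.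
Import Order.TTheory GRing.Theory Num.Theory.
Import numFieldNormedType.Exports.
Local Open Scope classical_set_scope.
Local Open Scope ring_scope.

Set Implicit Arguments.
Unset Strict Implicit.
Unset Printing Implicit Defensive.

(** * Euclidean and spectral norms *)

(** Both bias bounds go through a remainder [r] with [|r| <= K |h|]. The Taylor remainders divided
    by [c] are of order [|h|^2] and [|h|^3]; the surplus powers are spent on [|h| <= 2], so that
    together with the factor [h] of [S] exactly [gamma |h|^2] is left under the expectation. Its
    mean is known while [gamma] itself has no a priori bound: this is why [gamma] disappears from
    the bias and a single factor [n] remains. The variance keeps one [gamma]: in the square of a
    coordinate of [S], one [gamma] goes with [h_k^2], of mean [1 - 1 / n], the other stays outside,
    and summing the coordinates gives [n]. The formal obstacle is that [Z] and the evaluations are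
    controlled on the simplex only, while laws and product measures live on the whole space; hence
    the extensions by 0. Signs and finiteness are derived: [gamma > 0] from (MC2), [L2 >= 0] from
    two vertices, boundedness of the suprema from the Lipschitz bounds, integrability from moment
    bounds. *)

Section EuclideanTheory.
Context {R : realType} {n : nat}.
Implicit Types (u v w : 'cV[R]_n) (A B : 'M[R]_n) (a : R).

Lemma dotE u v : dot u v = \sum_i u i 0 * v i 0.
Proof. by rewrite /dot mxE; apply: eq_bigr => i _; rewrite mxE. Qed.

Lemma dotC u v : dot u v = dot v u.
Proof. by rewrite !dotE; apply: eq_bigr => i _; rewrite mulrC. Qed.

Lemma dotDl u v w : dot (u + v) w = dot u w + dot v w.
Proof.
by rewrite !dotE -big_split; apply: eq_bigr => i _; rewrite mxE mulrDl.
Qed.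

Lemma dotZl a u v : dot (a *: u) v = a * dot u v.
Proof. by rewrite !dotE mulr_sumr; apply: eq_bigr => i _; rewrite mxE mulrA. Qed.

Lemma dotNl u v : dot (- u) v = - dot u v.
Proof. by rewrite -scaleN1r dotZl mulN1r. Qed.

Lemma dotBl u v w : dot (u - v) w = dot u w - dot v w.
Proof. by rewrite dotDl dotNl. Qed.

Lemma dotDr u v w : dot u (v + w) = dot u v + dot u w.
Proof. by rewrite dotC dotDl !(dotC u). Qed.

Lemma dotZr a u v : dot u (a *: v) = a * dot u v.
Proof. by rewrite dotC dotZl (dotC u). Qed.

Lemma dotBr u v w : dot u (v - w) = dot u v - dot u w.
Proof. by rewrite dotC dotBl !(dotC u). Qed.

Lemma dot_ge0 u : 0 <= dot u u.
Proof. by rewrite dotE sumr_ge0 // => i _; rewrite -expr2 sqr_ge0. Qed.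

Lemma dot_delta u i : dot u (delta_mx i 0) = u i 0.
Proof.
rewrite dotE (bigD1 i)//= mxE !eqxx mulr1 big1 ?addr0// => j ji.
by rewrite mxE (negbTE ji) mulr0.
Qed.

Lemma dotvv_eq0 u v : dot v v = 0 -> dot u v = 0.
Proof.
rewrite !dotE => /eqP; rewrite psumr_eq0; last first.
  by move=> i _; rewrite -expr2 sqr_ge0.
move=> /allP v0; rewrite big1// => i _.
by have /v0 := mem_index_enum i; rewrite /= mulf_eq0 orbb => /eqP ->; rewrite mulr0.
Qed.

Lemma enorm_ge0 u : 0 <= enorm u. Proof. exact: sqrtr_ge0. Qed.

Lemma sqr_enorm u : enorm u ^+ 2 = dot u u.
Proof. by rewrite sqr_sqrtr// dot_ge0. Qed.

(** Cauchy-Schwarz, read off the squared norm of the component of [u] orthogonal to [v], scaled by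
    [dot v v] to avoid a division. *)
Lemma sqr_dot_le u v : dot u v ^+ 2 <= dot u u * dot v v.
Proof.
have := dot_ge0 v; rewrite le_eqVlt => /predU1P[/esym v0|v0].
  by rewrite dotvv_eq0// expr0n v0 mulr0.
have := dot_ge0 (dot v v *: u - dot u v *: v).
rewrite dotBl !dotBr !dotZl !dotZr (dotC v u).
rewrite (_ : _ - _ = dot v v * (dot u u * dot v v - dot u v ^+ 2)); last by ring.
by rewrite pmulr_rge0// subr_ge0.
Qed.

Lemma dot_le u v : `|dot u v| <= enorm u * enorm v.
Proof.
rewrite -(ler_pXn2r (n := 2))// ?nnegrE ?mulr_ge0 ?enorm_ge0//.
by rewrite exprMn !sqr_enorm real_normK ?num_real// sqr_dot_le.
Qed.

Lemma enorm_le u a : 0 <= a -> dot u u <= a ^+ 2 -> enorm u <= a.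
Proof.
by move=> a0 ua; rewrite -(ler_pXn2r (n := 2))// ?nnegrE ?enorm_ge0// sqr_enorm.
Qed.

Lemma enormD u v : enorm (u + v) <= enorm u + enorm v.
Proof.
apply: enorm_le; rewrite ?addr_ge0 ?enorm_ge0//.
rewrite dotDl !dotDr sqrrD -!sqr_enorm (dotC v u).
have := le_trans (ler_norm _) (dot_le u v); lra.
Qed.

Lemma enormZ a u : enorm (a *: u) = `|a| * enorm u.
Proof. by rewrite /enorm dotZl dotZr mulrA -expr2 sqrtrM ?sqr_ge0// sqrtr_sqr. Qed.

Lemma enorm0 : enorm (0 : 'cV[R]_n) = 0.
Proof. by rewrite /enorm dotE big1 ?sqrtr0// => i _; rewrite mxE mul0r. Qed.

Lemma coord_le_enorm u i : `|u i 0| <= enorm u.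
Proof.
rewrite -(ler_pXn2r (n := 2))// ?nnegrE ?enorm_ge0// sqr_enorm dotE.
rewrite (bigD1 i)//= real_normK ?num_real// -expr2 lerDl sumr_ge0// => j _.
by rewrite -expr2 sqr_ge0.
Qed.

Lemma mulmx_row A u i : (A *m u) i 0 = dot (row i A)^T u.
Proof. by rewrite dotE mxE; apply: eq_bigr => j _; rewrite !mxE. Qed.

(** Cauchy-Schwarz row by row bounds the set by the Frobenius norm. Without boundedness [sup] would
    be its default value 0. *)
Lemma specnorm_set_has_sup A :
  has_sup [set enorm (A *m x) | x in [set x : 'cV[R]_n | enorm x <= 1]].
Proof.
split; first by exists (enorm (A *m 0)), 0 => //=; rewrite enorm0.
pose f := \sum_i dot (row i A)^T (row i A)^T.
have f0 : 0 <= f by rewrite sumr_ge0// => i _; exact: dot_ge0.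
exists (Num.sqrt f) => _ [x /= x1 <-].
rewrite /enorm ler_sqrt// dotE ler_sum// => i _.
rewrite !mulmx_row -expr2 (le_trans (sqr_dot_le _ _))//.
by rewrite ler_piMr ?dot_ge0// -sqr_enorm expr_le1// enorm_ge0.
Qed.

Lemma specnorm_le_unit A u : enorm u <= 1 -> enorm (A *m u) <= specnorm A.
Proof. by move=> u1; apply: (ub_le_sup (proj2 (specnorm_set_has_sup A))); exists u. Qed.

Lemma specnorm_ge0 A : 0 <= specnorm A.
Proof.
by apply: le_trans (@specnorm_le_unit A 0 _); rewrite ?enorm_ge0// enorm0.
Qed.

Lemma enorm_eq0_mul A u : enorm u = 0 -> enorm (A *m u) = 0.
Proof.
move=> u0; have v0 : dot u u = 0 by rewrite -sqr_enorm u0 expr0n.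
suff -> : A *m u = 0 by rewrite enorm0.
by apply/matrixP => i j; rewrite ord1 mulmx_row dotvv_eq0// mxE.
Qed.

Lemma enorm_mulmx A u : enorm (A *m u) <= specnorm A * enorm u.
Proof.
have := enorm_ge0 u; rewrite le_eqVlt => /predU1P[/esym u0|u0].
  by rewrite enorm_eq0_mul// u0 mulr0.
rewrite -ler_pdivrMr// mulrC.
rewrite -[(enorm u)^-1]ger0_norm ?invr_ge0 ?enorm_ge0// -enormZ scalemxAr.
by apply: specnorm_le_unit; rewrite enormZ ger0_norm ?invr_ge0 ?enorm_ge0// mulVf ?gt_eqF.
Qed.

Lemma specnormD A B : specnorm (A + B) <= specnorm A + specnorm B.
Proof.
apply: ge_sup; first by case: (specnorm_set_has_sup (A + B)).
move=> _ [x /= x1 <-]; rewrite mulmxDl (le_trans (enormD _ _))//.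
by rewrite lerD// specnorm_le_unit.
Qed.

Lemma dot_mulmx_le A u : `|dot u (A *m u)| <= specnorm A * enorm u ^+ 2.
Proof.
rewrite (le_trans (dot_le _ _))// expr2 mulrA [leRHS]mulrC ler_wpM2l ?enorm_ge0//.
exact: enorm_mulmx.
Qed.

Lemma simplex_le1 u i : simplex n u -> 0 <= u i 0 <= 1.
Proof.
move=> [u1 u0]; rewrite u0/= -u1 (bigD1 i)//= lerDl sumr_ge0// => j _.
Qed.

(** Coordinatewise [(u_i - v_i)^2 <= u_i + v_i], so the squared distance is at most 2; the cruder
    bound 2 on the distance keeps later constants rational. *)
Lemma enorm_simplex_le2 u v : simplex n u -> simplex n v -> enorm (u - v) <= 2.
Proof.
move=> su sv; apply: enorm_le => //.
suff : dot (u - v) (u - v) <= 1 + 1 by move=> /le_trans -> //; lra.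
rewrite -{1}(proj1 su) -(proj1 sv) dotE -big_split ler_sum// => i _.
have /andP[? ?] := simplex_le1 i su; have /andP[? ?] := simplex_le1 i sv.
by rewrite !mxE/=; nra.
Qed.

Lemma sum_simplexB u v : simplex n u -> simplex n v -> \sum_i (u - v) i 0 = 0.
Proof.
move=> [u1 _] [v1 _]; under eq_bigr do rewrite !mxE.
by rewrite sumrB u1 v1 subrr.
Qed.

Lemma simplex_segment u v t : simplex n u -> simplex n v -> 0 <= t <= 1 ->
  simplex n (u + t *: (v - u)).
Proof.
move=> su sv /andP[t0 t1]; split.
  under eq_bigr do rewrite mxE [X in _ + X]mxE.
  by rewrite big_split/= -mulr_sumr sum_simplexB// mulr0 addr0; case: su.
move=> i; have /andP[? ?] := simplex_le1 i su.
have /andP[? ?] := simplex_le1 i sv.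
by rewrite !mxE; nra.
Qed.

Lemma simplex_vertex i : simplex n (delta_mx i 0 : 'cV[R]_n).
Proof.
split; last by move=> j; rewrite mxE.
rewrite (bigD1 i)//= mxE !eqxx big1 ?addr0// => j ji.
by rewrite mxE (negbTE ji).
Qed.

End EuclideanTheory.

(** * Calculus along segments of the simplex *)

Lemma cvg_sumr (R : realType) (T I : Type) (r : seq I) (G : set_system T)
    (f : I -> T -> R) (l : I -> R) : Filter G ->
  (forall i, f i x @[x --> G] --> l i) ->
  \sum_(i <- r) f i x @[x --> G] --> \sum_(i <- r) l i.
Proof.
move=> FG fl; elim: r => [|i r IH].
  by under eq_fun do rewrite big_nil; rewrite big_nil; exact: cvg_cst.
by under eq_fun do rewrite big_cons; rewrite big_cons; exact: cvgD.
Qed.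

Section SegmentCalculus.
Context {R : realType} {n : nat}.
Implicit Types (F Z : 'cV[R]_n -> R) (p q u v g : 'cV[R]_n).

(** The body of [sdifferentiable] with its witness named. Such a [g] is determined only up to
    multiples of the all-ones vector. *)
Definition has_sgradient F x g : Prop :=
  let near_x := within (simplex n) (nbhs x) in
  (fun q => F q - F x - dot g (q - x)) =o_near_x (fun q => enorm (q - x)).

(** The filter [G] stays abstract to serve both the one-sided limit in [spartial] and the two-sided
    limit of the derivative along a segment. *)
Lemma cvg_line_quotient F x g v (G : set_system R) : ProperFilter G ->
  has_sgradient F x g ->
  G --> (0 : R) ->
  (\forall s \near G, s != 0 /\ simplex n (x + s *: v)) ->
  (F (x + s *: v) - F x) / s @[s --> G] --> dot g v.
Proof.
move=> FG /eqoP Fo G0 GS; apply/cvgrPdist_le => e e0.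
(* The [+ 1] covers [v = 0]. *)
have e'0 : 0 < e / (enorm v + 1) by rewrite divr_gt0// ltr_wpDl ?enorm_ge0.
have xsv : x + s *: v @[s --> G] --> x.
  rewrite -[X in _ --> X]addr0 -(scale0r v).
  by apply: cvgD; [exact: cvg_cst|apply: cvgZr_tmp; exact: G0].
have := xsv _ (Fo _ e'0); rewrite /nbhs/= => near1.
near=> s.
have [s0 Ss] : s != 0 /\ simplex n (x + s *: v) by near: s.
have : simplex n (x + s *: v) ->
  `|F (x + s *: v) - F x - dot g (x + s *: v - x)| <=
    e / (enorm v + 1) * `|enorm (x + s *: v - x)| by near: s.
move=> /(_ Ss); rewrite [x + _]addrC addrK dotZr enormZ.
rewrite (ger0_norm (mulr_ge0 (normr_ge0 s) (enorm_ge0 v))) [s *: v + x]addrC.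
set D := F _ - F x => le1.
rewrite (_ : _ - _ = - s^-1 * (D - s * dot g v)); last by field.
rewrite normrM normrN normfV ler_pdivrMl ?normr_gt0// (le_trans le1)//.
rewrite mulrCA ler_wpM2l// -mulrA ler_piMr ?(ltW e0)//.
by rewrite mulrC ler_pdivrMr ?ltr_wpDl ?enorm_ge0// mul1r lerDl.
Unshelve. all: by end_near. Qed.

Lemma spartial_diff F x g i : simplex n x ->
  has_sgradient F x g ->
  spartial i F x = dot g (delta_mx i 0 - x).
Proof.
move=> sx Fo; rewrite /spartial; apply: cvg_lim => //.
under eq_fun => e.
  rewrite (_ : (1 - e) *: x + e *: _ = x + e *: (delta_mx i 0 - x)); last first.
    by rewrite scalerBl scale1r scalerBr addrAC addrA.
  over.
apply: cvg_line_quotient => //; first exact: cvg_at_right_filter.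
near=> s; split; first by rewrite gt_eqF.
apply: simplex_segment => //; first exact: simplex_vertex.
by apply/andP; split => //; near: s; apply: nbhs_right_le.
Unshelve. all: by end_near. Qed.

(** By [spartial_diff], [sgrad F x] is [g] minus [dot g x] times the all-ones vector, a shift that
    zero-sum directions do not see. *)
Lemma dot_sgrad F x g v : simplex n x ->
  has_sgradient F x g ->
  \sum_i v i 0 = 0 -> dot (sgrad F x) v = dot g v.
Proof.
move=> sx Fo v0; rewrite dotE.
under eq_bigr do rewrite mxE (spartial_diff _ sx Fo) dotBr dot_delta mulrBl.
by rewrite sumrB -mulr_sumr v0 mulr0 subr0 -dotE.
Qed.

Lemma is_derive_segment F u v (t : R) : simplex n u -> simplex n v ->
  (forall q, simplex n q -> sdifferentiable F q) -> 0 < t < 1 ->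
  is_derive t 1 (fun s => F (u + s *: (v - u)))
    (dot (sgrad F (u + t *: (v - u))) (v - u)).
Proof.
move=> su sv Fd t01; have /andP[t0 t1] := t01.
pose x := u + t *: (v - u).
have sx : simplex n x by apply: simplex_segment => //; rewrite !ltW.
have [g Fo] := Fd x sx; rewrite -/x (dot_sgrad sx Fo) ?sum_simplexB//.
have H : (fun h => h^-1 *: (F (u + (h *: 1 + t) *: (v - u)) - F x)) @ 0^' -->
    dot g (v - u).
  under eq_fun => h.
    rewrite (_ : u + _ = x + h *: (v - u)); last first.
      by rewrite scalerDl [h *: 1]mulr1 [X in u + X]addrC addrA.
    rewrite [_ *: _]mulrC.
    over.
  apply: cvg_line_quotient => //; first exact: cvg_within.
  near=> s; split; first by near: s; exact: nbhs_dnbhs_neq.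
  rewrite /x -addrA -scalerDl; apply: simplex_segment => //.
  (* Steps of either sign up to this length keep the point on the segment, which is why [t] has to
     be interior. *)
  have : `|s| <= Num.min t (1 - t).
    near: s; apply: dnbhs0_le.
    by rewrite lt_min t0 subr_gt0.
  by rewrite le_min !ler_norml => /andP[/andP[? ?] /andP[? ?]]; lra.
apply: DeriveDef; first by apply/cvg_ex; exists (dot g (v - u)).
by apply: cvg_lim.
Unshelve. all: by end_near. Qed.

Lemma continuous_segment F u v : simplex n u -> simplex n v ->
  {within simplex n, continuous F} ->
  {within `[0, 1], continuous (fun s : R => F (u + s *: (v - u)))}.
Proof.
move=> su sv /subspace_continuousP cF; apply/subspace_continuousP => t t01.
have cv : {for t, continuous (fun s : R => u + s *: (v - u))}.
  by apply: cvgD; [exact: cvg_cst|apply: cvgZr_tmp; exact: cvg_id].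
suff : (fun s : R => u + s *: (v - u)) @ within `[0, 1] (nbhs t) -->
    within (simplex n) (nbhs (u + t *: (v - u))).
  by move=> cw A FA; exact: (cw _ (cF _ (simplex_segment su sv t01) A FA)).
move=> A /cv cvA; apply: (@filterS _ (nbhs t) _ _ _ _ cvA) => s /= As s01.
by apply: As; exact: simplex_segment.
Qed.

Lemma mean_value_segment F u v (c : R) : simplex n u -> simplex n v ->
  {within simplex n, continuous F} ->
  (forall q, simplex n q -> sdifferentiable F q) -> 0 <= c <= 1 ->
  exists2 s, 0 <= s <= c &
    F (u + c *: (v - u)) - F u = dot (sgrad F (u + s *: (v - u))) (v - u) * c.
Proof.
move=> su sv cF Fd /andP[c0 c1].
have [s|s|s sc] := @MVT_segment _ (fun s => F (u + s *: (v - u)))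
  (fun s => dot (sgrad F (u + s *: (v - u))) (v - u)) 0 c c0.
- rewrite in_itv/= => /andP[s0 sc]; apply: is_derive_segment => //.
  by rewrite s0 (lt_le_trans sc).
- apply: continuous_subspaceW (continuous_segment su sv cF) _ => //.
  by apply: subset_itvl; rewrite bnd_simp.
- by rewrite scale0r addr0 subr0 => E; exists s.
Qed.

Lemma is_derive_dot_sgrad Z u v (t : R) : simplex n u -> simplex n v ->
  sC 2 Z -> 0 < t < 1 ->
  is_derive t 1 (fun s => dot (sgrad Z (u + s *: (v - u))) (v - u))
    (dot (v - u) (shess Z (u + t *: (v - u)) *m (v - u))).
Proof.
move=> su sv [_ [_ Zi]] t01.
rewrite (_ : (fun s => _) = \sum_i
    ((v - u) i 0 \*: (fun s => spartial i Z (u + s *: (v - u))))); last first.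
  apply/funext => s; rewrite dotE fct_sumE; apply: eq_bigr => i _.
  by rewrite mxE mulrC.
rewrite dotE; apply: is_derive_sum => i.
have [_ [Zid _]] := Zi i.
have := is_derive_segment su sv Zid t01; set l := dot _ _ => dl.
apply: is_derive_eq.
congr (_ * _); rewrite /l dotE [RHS]mxE; apply: eq_bigr => j _.
by rewrite !mxE.
Qed.

Lemma continuous_dot_sgrad Z u v : simplex n u -> simplex n v -> sC 2 Z ->
  {within `[0, 1], continuous
    (fun s : R => dot (sgrad Z (u + s *: (v - u))) (v - u))}.
Proof.
move=> su sv [_ [_ Zi]].
rewrite (_ : (fun s => _) = fun s => \sum_i
    (v - u) i 0 * spartial i Z (u + s *: (v - u))); last first.
  by apply/funext => s; rewrite dotE; apply: eq_bigr => i _; rewrite mxE mulrC.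
apply/subspace_continuousP => t t01.
apply: cvg_sumr => i.
apply: cvgMl_tmp; have [cZi _] := Zi i.
by have /subspace_continuousP := continuous_segment su sv cZi; exact.
Qed.

(* The mean value theorem is applied twice, to
   [t |-> Z (u + t h) - t a - t^2 b / 2] and to its derivative. *)
Lemma taylor_segment Z u v (b c : R) : simplex n u -> simplex n v -> sC 2 Z ->
  0 <= c <= 1 ->
  exists s r, [/\ 0 <= s <= c, 0 <= r <= s &
    Z (u + c *: (v - u)) - Z u - c * dot (sgrad Z u) (v - u) - c ^+ 2 / 2 * b =
    c * s * (dot (v - u) (shess Z (u + r *: (v - u)) *m (v - u)) - b)].
Proof.
move=> su sv Z2 /andP[c0 c1]; have [cZ [Zd _]] := Z2.
have inI (x y : R) : y <= 1 -> `[x, y] `<=` [set` `[x, 1]].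
  by move=> y1; apply: subset_itvl; rewrite bnd_simp.
pose a := dot (sgrad Z u) (v - u).
(* A polynomial, so that both of its derivatives come from symbolic derivation. *)
pose P : {poly R} := a *: 'X + (b / 2) *: 'X^2.
have PE s : P.[s] = a * s + b / 2 * s ^+ 2 by rewrite /P !hornerE.
have P' : P^`() = a%:P + b *: 'X.
  rewrite /P derivD !derivZ derivX derivXn/= expr1 alg_polyC.
  by rewrite -scalerMnr scalerMnl -mulr_natr divfK.
have P'E s : P^`().[s] = a + b * s by rewrite P' !hornerE.
have [s|s|s sc] := @MVT_segment _ ((fun s => Z (u + s *: (v - u))) \- horner P)
  (fun s => dot (sgrad Z (u + s *: (v - u))) (v - u) - P^`().[s]) 0 c c0.
- rewrite in_itv/= => /andP[s0 sc].
  have := is_derive_segment su sv Zd (_ : 0 < s < 1).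
  by rewrite s0 (lt_le_trans sc)// => /(_ isT) ?; exact: is_deriveB.
- move=> x; apply: continuousB.
    by apply: continuous_subspaceW (continuous_segment su sv cZ) _; exact: inI.
  by apply: continuous_subspaceT => y; exact: continuous_horner.
move: sc; rewrite in_itv/= => /andP[s0 sc].
rewrite /= scale0r addr0 subr0 !PE P'E => Ec.
have s1 := le_trans sc c1.
have [r|r|r rs] := @MVT_segment _
  ((fun s => dot (sgrad Z (u + s *: (v - u))) (v - u)) \- horner P^`())
  (fun s => dot (v - u) (shess Z (u + s *: (v - u)) *m (v - u)) - P^`()^`().[s])
  0 s s0.
- rewrite in_itv/= => /andP[r0 rs].
  have := is_derive_dot_sgrad su sv Z2 (_ : 0 < r < 1).
  by rewrite r0 (lt_le_trans rs)// => /(_ isT) ?; exact: is_deriveB.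
- move=> x; apply: continuousB.
    by apply: continuous_subspaceW (continuous_dot_sgrad su sv Z2) _; exact: inI.
  by apply: continuous_subspaceT => y; exact: continuous_horner.
move: rs; rewrite in_itv/= => /andP[r0 rs].
rewrite /= scale0r addr0 subr0 !P'E (_ : P^`()^`().[r] = b); last first.
  by rewrite P' derivD derivC derivZ derivX !hornerE.
rewrite -/a => Es; exists s, r; split; rewrite ?s0 ?r0//.
move: Ec Es; rewrite -/a; set A := Z _; set B := Z u; set D := dot _ _.
set E := dot _ _ => Ec Es.
rewrite (_ : A - B - _ - _ = A - (a * c + b / 2 * c ^+ 2)
  - (B - (a * 0 + b / 2 * 0 ^+ 2))); last by field.
rewrite Ec (_ : D - _ = D - (a + b * s) - (a - (a + b * 0))); last by ring.
by rewrite Es; ring.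
Qed.

End SegmentCalculus.

(** * Suprema of the derivatives and bounds on Taylor remainders *)

Section TaylorBounds.
Context {R : realType} {n : nat}.
Variable (Z : 'cV[R]_n -> R).
Hypothesis Z2 : sC 2 Z.
Implicit Types (p q u v : 'cV[R]_n) (c L : R).

(** The supremum is a genuine one: the Lipschitz bound and the diameter of the simplex bound the
    gradient in terms of its value at [q]. *)
Lemma sgrad_le_sup L q :
  (forall q r, simplex n q -> simplex n r ->
     enorm (sgrad Z q - sgrad Z r) <= L * enorm (q - r)) ->
  simplex n q ->
  enorm (sgrad Z q) <= sup [set enorm (sgrad Z q) | q in simplex n].
Proof.
move=> lipZ sq; apply: ub_le_sup; last by exists q.
exists (enorm (sgrad Z q) + `|L| * 2) => _ [r sr <-].
rewrite -[sgrad Z r](subrK (sgrad Z q)) addrC (le_trans (enormD _ _))// lerD2l.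
rewrite (le_trans (lipZ _ _ sr sq))// (le_trans (ler_norm _))//.
rewrite normrM ler_wpM2l// ger0_norm ?enorm_ge0//; exact: enorm_simplex_le2.
Qed.

Lemma shess_le_sup L q :
  (forall q r, simplex n q -> simplex n r ->
     specnorm (shess Z q - shess Z r) <= L * enorm (q - r)) ->
  simplex n q ->
  specnorm (shess Z q) <= sup [set specnorm (shess Z q) | q in simplex n].
Proof.
move=> lipZ sq; apply: ub_le_sup; last by exists q.
exists (specnorm (shess Z q) + `|L| * 2) => _ [r sr <-].
rewrite -[shess Z r](subrK (shess Z q)) addrC (le_trans (specnormD _ _))//.
rewrite lerD2l (le_trans (lipZ _ _ sr sq))// (le_trans (ler_norm _))//.
rewrite normrM ler_wpM2l// ger0_norm ?enorm_ge0//; exact: enorm_simplex_le2.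
Qed.

Lemma increment_le u v c M : simplex n u -> simplex n v -> 0 <= c <= 1 ->
  (forall q, simplex n q -> enorm (sgrad Z q) <= M) ->
  `|Z (u + c *: (v - u)) - Z u| <= c * M * enorm (v - u).
Proof.
move=> su sv c01 ZM; have [cZ [Zd _]] := Z2; have /andP[c0 c1] := c01.
have [s /andP[s0 sc] ->] := mean_value_segment su sv cZ Zd c01.
rewrite normrM (ger0_norm c0) mulrC -mulrA ler_wpM2l//.
rewrite (le_trans (dot_le _ _))// ler_wpM2r ?enorm_ge0//; apply: ZM.
by apply: simplex_segment => //; rewrite s0 (le_trans sc).
Qed.

(** The case [b = 0] of [taylor_segment], where the remainder is a Hessian form at an intermediate
    point and [s <= c]. *)
Lemma taylor1_le u v c M : simplex n u -> simplex n v -> 0 <= c <= 1 ->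
  (forall q, simplex n q -> specnorm (shess Z q) <= M) ->
  `|Z (u + c *: (v - u)) - Z u - c * dot (sgrad Z u) (v - u)| <=
    c ^+ 2 * M * enorm (v - u) ^+ 2.
Proof.
move=> su sv c01 ZM; have /andP[c0 c1] := c01.
have [s [r [/andP[s0 sc] /andP[r0 rs]]]] := taylor_segment 0 su sv Z2 c01.
rewrite mulr0 !subr0 => ->.
rewrite normrM (ger0_norm (mulr_ge0 c0 s0)) -[leRHS]mulrA ler_pM ?mulr_ge0//.
  by rewrite expr2 ler_wpM2l.
rewrite (le_trans (dot_mulmx_le _ _))// ler_wpM2r ?exprn_ge0 ?enorm_ge0//.
by apply: ZM; apply: simplex_segment => //; rewrite r0 (le_trans rs)// (le_trans sc).
Qed.

(** With [b] the Hessian form at [u], the remainder of [taylor_segment] becomes the form of a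
    difference of Hessians at points at most [c * enorm (v - u)] apart. *)
Lemma taylor2_le u v c L : simplex n u -> simplex n v -> 0 <= c <= 1 ->
  (forall q r, simplex n q -> simplex n r ->
     specnorm (shess Z q - shess Z r) <= L * enorm (q - r)) ->
  `|Z (u + c *: (v - u)) - Z u - c * dot (sgrad Z u) (v - u)
     - c ^+ 2 / 2 * dot (v - u) (shess Z u *m (v - u))| <=
    c ^+ 3 * L * enorm (v - u) ^+ 3.
Proof.
move=> su sv c01 lipZ; have /andP[c0 c1] := c01.
have [s [r [/andP[s0 sc] /andP[r0 rs] ->]]] :=
  taylor_segment (dot (v - u) (shess Z u *m (v - u))) su sv Z2 c01.
rewrite -dotBr -mulmxBl normrM (ger0_norm (mulr_ge0 c0 s0)).
have -> : c ^+ 3 * L * enorm (v - u) ^+ 3 =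
    c ^+ 2 * ((L * (c * enorm (v - u))) * enorm (v - u) ^+ 2) by ring.
rewrite ler_pM ?mulr_ge0//; first by rewrite expr2 ler_wpM2l.
rewrite (le_trans (dot_mulmx_le _ _))// ler_wpM2r ?exprn_ge0 ?enorm_ge0//.
have r01 : 0 <= r <= 1 by rewrite r0 (le_trans rs)// (le_trans sc).
rewrite (le_trans (lipZ _ _ (simplex_segment su sv r01) su))//.
rewrite addrC addKr enormZ (ger0_norm r0) mulrCA [leRHS]mulrCA.
rewrite ler_wpM2r ?(le_trans rs)//.
(* The sign of [L] is not given; [L * enorm (v - u)] is nonnegative because it bounds a norm. *)
by rewrite (le_trans (specnorm_ge0 (shess Z v - shess Z u)))// lipZ.
Qed.

(** For [n >= 2] the simplex has two distinct vertices, and a Lipschitz bound across a positive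
    distance forces the sign of [L]. *)
Lemma shess_lipschitz_ge0 L : (2 <= n)%N ->
  (forall q r, simplex n q -> simplex n r ->
     specnorm (shess Z q - shess Z r) <= L * enorm (q - r)) -> 0 <= L.
Proof.
move=> n2 lipZ.
pose i := Ordinal (ltnW n2); pose j := Ordinal n2.
pose u : 'cV[R]_n := delta_mx i 0; pose v : 'cV[R]_n := delta_mx j 0.
have uv0 : 0 < enorm (u - v).
  apply: lt_le_trans (coord_le_enorm (u - v) i).
  by rewrite !mxE eqxx/= subr0 normr1.
have := lipZ u v (simplex_vertex i) (simplex_vertex j).
by move/(le_trans (specnorm_ge0 _)); rewrite pmulr_lge0.
Qed.

End TaylorBounds.

(** * Random vectors and integrability *)

Section BorelVectors.
Context {R : realType} {n : nat}.

Lemma continuous_measurable_cV (f : 'cV[R]_n -> R) :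
  continuous f -> measurable_fun setT (f : borel_cV R n -> R).
Proof.
move=> /continuousP cf; apply: (measurability _ (RGenOpens.measurableE R)).
move=> _ [_ [a [b ->] <-]]; rewrite setTI.
by apply: sub_sigma_algebra; exact/cf/interval_open.
Qed.

Lemma continuous_measurable_cV_cV (f : 'cV[R]_n -> 'cV[R]_n) :
  continuous f -> measurable_fun setT (f : borel_cV R n -> borel_cV R n).
Proof.
move=> /continuousP cf; apply: (@measurability _ _ (borel_cV R n) (borel_cV R n) setT f
  (@open _)) => //.
by move=> _ [U oU <-]; rewrite setTI; apply: sub_sigma_algebra; exact: cf.
Qed.

Lemma closed_measurable_cV (A : set 'cV[R]_n) :
  closed A -> measurable (A : set (borel_cV R n)).
Proof.
move=> cA; rewrite -[A]setCK; apply: measurableC.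
by apply: sub_sigma_algebra; exact: closed_openC.
Qed.

Lemma closed_simplex : closed (simplex n : set 'cV[R]_n).
Proof.
have cE i : continuous (fun p : 'cV[R]_n => p i 0) by exact: coord_continuous.
have -> : simplex n = (fun p : 'cV[R]_n => \sum_i p i 0) @^-1` [set 1] `&`
    \bigcap_i ((fun p : 'cV[R]_n => p i 0) @^-1` [set x | 0 <= x]).
  by apply/seteqP; split => [p [p1 p0]|p [p1 p0]]; split => // i *; exact: p0.
apply: closedI.
  apply: preimage_closed; last exact: closed_eq.
  by move=> p _; apply: (@cvg_sumr _ _ _ _ (nbhs p)) => i; exact: cE.
apply: closed_bigI => i _; apply: preimage_closed; last exact: closed_ge.
by move=> p _; exact: cE.
Qed.

Lemma measurable_simplex : measurable (simplex n : set (borel_cV R n)).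
Proof. by apply: closed_measurable_cV; exact: closed_simplex. Qed.

(** Relatively open sets are traces of open sets on the simplex, which is itself Borel. *)
Lemma within_simplex_measurable (F : 'cV[R]_n -> R) :
  {within simplex n, continuous F} ->
  measurable_fun (simplex n : set (borel_cV R n)) (F : borel_cV R n -> R).
Proof.
move=> /continuousP cF; apply: (measurability _ (RGenOpens.measurableE R)).
move=> _ [_ [a [b ->] <-]].
have oF : open ((F : subspace (simplex n) -> R) @^-1` `]a, b[%classic).
  exact/cF/interval_open.
have [V oV VE] := proj1 (open_subspaceP _ _) oF.
rewrite setIC -VE; apply: measurableI; last exact: measurable_simplex.
exact: sub_sigma_algebra.
Qed.

End BorelVectors.

(** * Integrability and expectation of real random variables *)

Section IntegrableRandomVariables.
Context {d : measure_display} {Omega : measurableType d} {R : realType}.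
Variable P : probability Omega R.
Implicit Types (X Y : Omega -> R).
Local Open Scope ereal_scope.

Lemma Lfun1_measurable X : X \in Lfun P 1 -> measurable_fun setT X.
Proof. by move=> /Lfun1_integrable/measurable_int/measurable_EFinP. Qed.

Lemma Lfun1_le X Y : measurable_fun setT X -> (forall w, `|X w| <= Y w)%R ->
  Y \in Lfun P 1 -> X \in Lfun P 1.
Proof.
move=> mX XY /Lfun1_integrable iY; apply/Lfun1_integrable.
apply: le_integrable iY => //; first exact/measurable_EFinP.
by move=> w _; rewrite !abse_EFin lee_fin (le_trans (XY w))// ler_norm.
Qed.

Lemma Lfun1_bounded X (K : R) : measurable_fun setT X ->
  (forall w, `|X w| <= K)%R -> X \in Lfun P 1.
Proof. by move=> mX XK; apply: (Lfun1_le mX XK); exact: Lfun_cst. Qed.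

(** For a nonnegative variable a finite bound on the expectation is integrability, so the
    second-moment bounds below double as integrability proofs. *)
Lemma Lfun1_ge0 X (K : R) : measurable_fun setT X -> (forall w, 0 <= X w)%R ->
  'E_P[X] <= K%:E -> X \in Lfun P 1.
Proof.
move=> mX X0 XK; apply/Lfun1_integrable/integrableP; split.
  exact/measurable_EFinP.
under eq_integral do rewrite /= ger0_norm//.
by apply: le_lt_trans (ltry K); move: XK; rewrite unlock.
Qed.

Lemma Lfun1_sqr X : measurable_fun setT X ->
  (fun w => X w ^+ 2)%R \in Lfun P 1 -> X \in Lfun P 1.
Proof.
move=> mX X2; apply: (@Lfun1_le _ (cst 1 \+ (fun w => X w ^+ 2))%R) => //.
  move=> w /=; have := sqr_ge0 (`|X w| - 1)%R.
  by rewrite sqrrB expr1n real_normK ?num_real//; have := normr_ge0 (X w); lra.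
by apply: rpredD => //; exact: Lfun_cst.
Qed.

Lemma Lfun1_mul X Y : measurable_fun setT X -> measurable_fun setT Y ->
  (fun w => X w ^+ 2)%R \in Lfun P 1 -> (fun w => Y w ^+ 2)%R \in Lfun P 1 ->
  (fun w => X w * Y w)%R \in Lfun P 1.
Proof.
move=> mX mY X2 Y2.
apply: (@Lfun1_le _ ((fun w => X w ^+ 2) \+ (fun w => Y w ^+ 2))%R).
- exact: measurable_funM.
- move=> w /=; have := sqr_ge0 (`|X w| - `|Y w|)%R.
  rewrite sqrrB normrM !real_normK ?num_real//.
  by have := mulr_ge0 (normr_ge0 (X w)) (normr_ge0 (Y w)); lra.
- exact: rpredD.
Qed.

Lemma Lfun1Z X (k : R) : X \in Lfun P 1 -> (fun w => k * X w)%R \in Lfun P 1.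
Proof.
move=> X1; rewrite (_ : (fun w => _) = (k \o* X)%R) ?Lfun_scale//.
by apply/funext => w /=; rewrite mulrC.
Qed.

Lemma Lfun1_sum (I : Type) (r : seq I) (X : I -> Omega -> R) :
  (forall i, X i \in Lfun P 1) ->
  (fun w => \sum_(i <- r) X i w)%R \in Lfun P 1.
Proof.
by move=> X1; rewrite -fct_sumE; exact: rpred_sum.
Qed.

Lemma expectation_sumr (I : Type) (r : seq I) (X : I -> Omega -> R) :
  (forall i, X i \in Lfun P 1) ->
  'E_P[fun w => \sum_(i <- r) X i w]%R = \sum_(i <- r) 'E_P[X i].
Proof.
move=> X1; elim: r => [|i r IH].
  by under [X in 'E_P[X]]eq_fun do rewrite big_nil; rewrite big_nil expectation_cst.
under [X in 'E_P[X]]eq_fun do rewrite big_cons.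
by rewrite expectationD ?Lfun1_sum// IH big_cons.
Qed.

Lemma expectationZr X (k : R) : X \in Lfun P 1 ->
  'E_P[fun w => k * X w]%R = k%:E * 'E_P[X].
Proof.
move=> X1; rewrite -expectationZl//; congr expectation.
by apply/funext => w /=; rewrite mulrC.
Qed.

Lemma expectation_ge0_le X Y : measurable_fun setT X -> measurable_fun setT Y ->
  (forall w, 0 <= X w <= Y w)%R -> 'E_P[X] <= 'E_P[Y].
Proof.
move=> mX mY XY; apply: expectation_le => //.
- by move=> w; case/andP: (XY w).
- by move=> w; case/andP: (XY w) => /le_trans; exact.
- by apply: aeW => w; case/andP: (XY w).
Qed.

Lemma expectation_real X : X \in Lfun P 1 -> exists a : R, 'E_P[X] = a%:E.
Proof.
by move=> /expectation_fin_num/fineK <-; exists (fine 'E_P[X]).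
Qed.

End IntegrableRandomVariables.

(** * Independence *)

Section Independence.
Context {d : measure_display} {Omega : measurableType d} {R : realType}.
Variable P : probability Omega R.
Local Open Scope ereal_scope.

Definition indep2 d1 d2 (T1 : measurableType d1) (T2 : measurableType d2)
    (X : Omega -> T1) (Y : Omega -> T2) :=
  forall A B, measurable A -> measurable B ->
    P (X @^-1` A `&` Y @^-1` B) = P (X @^-1` A) * P (Y @^-1` B).

Lemma measurable_preimage d1 (T1 : measurableType d1) (X : Omega -> T1) A :
  measurable_fun setT X -> measurable A -> measurable (X @^-1` A).
Proof. by move=> mX mA; rewrite -[_ @^-1` _]setTI; exact: mX. Qed.

Lemma indep2_comp d1 d2 d1' d2' (T1 : measurableType d1)
    (T2 : measurableType d2) (T1' : measurableType d1')
    (T2' : measurableType d2') (X : Omega -> T1) (Y : Omega -> T2)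
    (f : T1 -> T1') (g : T2 -> T2') :
  measurable_fun setT f -> measurable_fun setT g ->
  indep2 X Y -> indep2 (f \o X) (g \o Y).
Proof.
move=> mf mg XY A B mA mB.
have mfA : measurable (f @^-1` A) by rewrite -[_ @^-1` _]setTI; exact: mf.
have mgB : measurable (g @^-1` B) by rewrite -[_ @^-1` _]setTI; exact: mg.
exact: XY mfA mgB.
Qed.

(** Positive and negative parts are transported separately, so the identity covers infinite and
    undetermined integrals too. *)
Lemma integral_distribution_measurable d1 (T1 : measurableType d1)
    (X : {mfun Omega >-> T1}) (f : T1 -> \bar R) :
  measurable_fun setT f ->
  \int[distribution P X]_x f x = \int[P]_w f (X w).
Proof.
move=> mf; rewrite integralE -[fun w => f (X w)]/(f \o X) [RHS]integralE.
under [X in _ = X - _]eq_integral do rewrite funepos_comp.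
under [X in _ = _ - X]eq_integral do rewrite funeneg_comp.
rewrite ge0_integral_distribution//; last exact: measurable_funepos.
by rewrite ge0_integral_distribution//; exact: measurable_funeneg.
Qed.

Lemma expectation_identically_distributed d1 (T1 : measurableType d1)
    (X Y : Omega -> T1) (f : T1 -> R) :
  measurable_fun setT X -> measurable_fun setT Y -> measurable_fun setT f ->
  identically_distributed P X Y ->
  'E_P[fun w => f (X w)] = 'E_P[fun w => f (Y w)].
Proof.
move=> mX mY mf XY; rewrite unlock.
pose X' : {mfun Omega >-> T1} := HB.pack X (isMeasurableFun.Build _ _ _ _ _ mX).
pose Y' : {mfun Omega >-> T1} := HB.pack Y (isMeasurableFun.Build _ _ _ _ _ mY).
have mEf : measurable_fun setT (EFin \o f) by exact/measurable_EFinP.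
rewrite -(integral_distribution_measurable X' mEf).
rewrite -(integral_distribution_measurable Y' mEf).
by apply: eq_measure_integral => A mA _; exact: XY.
Qed.

Section IntegralOfIndependentPair.
Context d1 d2 (T1 : measurableType d1) (T2 : measurableType d2).
Variables (X : Omega -> T1) (Y : Omega -> T2).
Hypotheses (mX : measurable_fun setT X) (mY : measurable_fun setT Y).
Hypothesis XY : indep2 X Y.

Let X' : {mfun Omega >-> T1} := HB.pack X (isMeasurableFun.Build _ _ _ _ _ mX).
Let Y' : {mfun Omega >-> T2} := HB.pack Y (isMeasurableFun.Build _ _ _ _ _ mY).
Let mXY : measurable_fun setT (fun w => (X w, Y w)).
Proof. exact: measurable_fun_pair. Qed.
Let XY' : {mfun Omega >-> (T1 * T2)%type} :=
  HB.pack (fun w => (X w, Y w)) (isMeasurableFun.Build _ _ _ _ _ mXY).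

(** Independence says that the joint law agrees with the product law on rectangles, and these
    determine it. *)
Lemma indep2_distribution A : measurable A ->
  distribution P XY' A = (distribution P X' \x distribution P Y') A.
Proof.
move=> mA; apply/esym.
have /product_measure_unique -> // : forall B C, measurable B -> measurable C ->
    distribution P XY' (B `*` C) = distribution P X' B * distribution P Y' C.
  by move=> B C mB mC; exact: XY.
Qed.

(** Integration over [Y] with [X] frozen. The inner integral runs over a second copy of [Omega], so
    that moments of [Y] under [P] can be substituted directly. *)
Lemma indep2_tonelli (F : T1 * T2 -> \bar R) :
  measurable_fun setT F -> (forall z, 0 <= F z) ->
  \int[P]_w F (X w, Y w) = \int[P]_w \int[P]_w' F (X w, Y w').
Proof.
move=> mF F0.
have -> : \int[P]_w F (X w, Y w) = \int[distribution P XY']_z F z.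
  by rewrite ge0_integral_distribution.
rewrite (@eq_measure_integral _ _ _ _ (distribution P X' \x distribution P Y')).
  rewrite fubini_tonelli1//= ge0_integral_distribution.
  - apply: eq_integral => w _ /=; rewrite /fubini_F ge0_integral_distribution//.
    exact: measurableT_comp mF (pair1_measurable (X w)).
  - exact: measurable_fun_fubini_tonelli_F.
  - by move=> x; exact: integral_ge0.
by move=> A mA _; exact: indep2_distribution.
Qed.


(** [G] bounds the conditional expectation given [X]. For nonnegative [F] Tonelli applies before
    integrability is known; integrability is then deduced from the resulting bound. *)
Lemma indep2_expectation_le (F : T1 * T2 -> R) (G : Omega -> R) :
  measurable_fun setT F -> (forall z, 0 <= F z)%R ->
  measurable_fun setT G ->
  (forall w, 'E_P[fun w' => F (X w, Y w')] <= (G w)%:E) ->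
  'E_P[fun w => F (X w, Y w)] <= 'E_P[G].
Proof.
move=> mF F0 mG FG; rewrite unlock.
have mEF : measurable_fun setT (EFin \o F) by exact/measurable_EFinP.
have EF0 z : 0 <= (EFin \o F) z by rewrite /= lee_fin.
have mEFw w : measurable_fun setT (fun y => (EFin \o F) (X w, y)).
  exact: measurableT_comp mEF (pair1_measurable (X w)).
rewrite (@indep2_tonelli (EFin \o F))//.
apply: ge0_le_integral => //.
- by move=> w _; exact: integral_ge0.
- have := measurableT_comp (measurable_fun_fubini_tonelli_F
    (m2 := distribution P Y') _ mEF EF0) mX.
  apply: eq_measurable_fun => w _ /=.
  by rewrite /fubini_F ge0_integral_distribution.
- exact/measurable_EFinP.
- by move=> w _; have := FG w; rewrite unlock.
Qed.

(** A zero conditional mean given [X] gives a zero mean. As [F] may change sign, Fubini asks for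
    integrability under the product law, which is transported from that of [F (X, Y)] through the
    joint law. *)
Lemma indep2_expectation0 (F : T1 * T2 -> R) :
  measurable_fun setT F -> (fun w => F (X w, Y w)) \in Lfun P 1 ->
  (forall w, 'E_P[fun w' => F (X w, Y w')] = 0) ->
  'E_P[fun w => F (X w, Y w)] = 0.
Proof.
move=> mF /Lfun1_integrable iF F0; rewrite unlock.
have mEF : measurable_fun setT (EFin \o F) by exact/measurable_EFinP.
have iF' : (distribution P X' \x distribution P Y').-integrable setT (EFin \o F).
  apply/integrableP; split => //.
  rewrite -(@eq_measure_integral _ _ _ _ _ (distribution P XY')); last first.
    by move=> A mA _; exact: indep2_distribution.
  have mnF : measurable_fun setT (fun z => `|(EFin \o F) z|).
    exact: measurableT_comp.
  by rewrite ge0_integral_distribution//; case/integrableP: iF.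
transitivity (\int[distribution P XY']_z (EFin \o F) z).
  by rewrite integral_distribution_measurable.
rewrite (@eq_measure_integral _ _ _ _ (distribution P X' \x distribution P Y')).
  rewrite -integral12_prod_meas1//.
  rewrite (integral_distribution_measurable X' (measurable_fubini_F iF')).
  rewrite integral0_eq// => w _.
  have mEFw : measurable_fun setT (fun y => (EFin \o F) (X w, y)).
    exact: measurableT_comp mEF (pair1_measurable (X w)).
  rewrite /fubini_F (integral_distribution_measurable Y' mEFw).
  by have := F0 w; rewrite unlock.
by move=> A mA _; exact: indep2_distribution.
Qed.

End IntegralOfIndependentPair.

(** For fixed [B], both sides are finite measures in [A]. They agree on rectangles, which are stable
    under intersection and generate the product sigma-algebra, so they agree everywhere. *)
Lemma indep_pair_event d1 d2 (T1 : measurableType d1) (T2 : measurableType d2)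
    (X : Omega -> T1) (Y : Omega -> T2) (B : set Omega) :
  measurable_fun setT X -> measurable_fun setT Y -> measurable B ->
  (forall A1 A2, measurable A1 -> measurable A2 ->
    P ((X @^-1` A1 `&` Y @^-1` A2) `&` B) = P (X @^-1` A1 `&` Y @^-1` A2) * P B) ->
  forall A, measurable A ->
    P ((fun w => (X w, Y w)) @^-1` A `&` B) =
    P ((fun w => (X w, Y w)) @^-1` A) * P B.
Proof.
move=> mX mY mB H A mA.
have mXY : measurable_fun setT (fun w => (X w, Y w)).
  exact: measurable_fun_pair.
have PB0 : (0 <= fine (P B))%R by rewrite fine_ge0.
have PBE : (NngNum PB0)%:num%:E = P B by rewrite /= fineK ?fin_num_measure.
pose f w := (X w, Y w).
(* The left side is the image of [P] restricted to [B], the right side the image of [P] scaled by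
   the number [P B]. *)
suff E : pushforward (mrestr P mB) f A = mscale (NngNum PB0) (pushforward P f) A.
  by apply: (etrans (E mXY)); rewrite /mscale PBE muleC.
move=> mf.
apply: (@measure_unique _ R (T1 * T2)%type
  [set A1 `*` A2 | A1 in measurable & A2 in measurable] (fun _ => setT)
  (measurable_prod_measurableType _ _)) => //.
- move=> _ _ [A1 mA1 [A2 mA2 <-]] [B1 mB1 [B2 mB2 <-]]; rewrite -setXI.
  exists (A1 `&` B1); first exact: measurableI.
  by exists (A2 `&` B2) => //; exact: measurableI.
- by move=> _; exists setT => //; exists setT => //; rewrite setXTT.
- exact: bigcup_const.
- by move=> _ [A1 mA1 [A2 mA2 <-]]; rewrite /= /mscale PBE muleC; exact: H.
- by move=> _; rewrite /= /pushforward /mrestr preimage_setT setTI ltey_eq fin_num_measure.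
Qed.

(** [indep_pair_event] for the pair [((X, Y), W)]. Its hypothesis on rectangles comes from the same
    lemma for [(X, Y)], once against an event of [W] and once against that event intersected with
    [B]. *)
Lemma indep_triple_event d1 d2 d3 (T1 : measurableType d1)
    (T2 : measurableType d2) (T3 : measurableType d3) (X : Omega -> T1)
    (Y : Omega -> T2) (W : Omega -> T3) (B : set Omega) :
  measurable_fun setT X -> measurable_fun setT Y -> measurable_fun setT W ->
  measurable B ->
  (forall A1 A2 A3, measurable A1 -> measurable A2 -> measurable A3 ->
    P (X @^-1` A1 `&` Y @^-1` A2 `&` W @^-1` A3) =
    P (X @^-1` A1) * P (Y @^-1` A2) * P (W @^-1` A3)) ->
  (forall A1 A2 A3, measurable A1 -> measurable A2 -> measurable A3 ->
    P (X @^-1` A1 `&` Y @^-1` A2 `&` W @^-1` A3 `&` B) =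
    P (X @^-1` A1) * P (Y @^-1` A2) * P (W @^-1` A3) * P B) ->
  forall A, measurable A ->
    P ((fun w => (X w, Y w, W w)) @^-1` A `&` B) =
    P ((fun w => (X w, Y w, W w)) @^-1` A) * P B.
Proof.
move=> mX mY mW mB H3 H4 A mA.
have mXY : measurable_fun setT (fun w => (X w, Y w)).
  exact: measurable_fun_pair.
have HXY A1 A2 : measurable A1 -> measurable A2 ->
    P (X @^-1` A1 `&` Y @^-1` A2) = P (X @^-1` A1) * P (Y @^-1` A2).
  move=> mA1 mA2; have := H3 A1 A2 setT mA1 mA2 measurableT.
  by rewrite preimage_setT setIT probability_setT mule1.
have HW3 C A3 : measurable C -> measurable A3 ->
    P ((fun w => (X w, Y w)) @^-1` C `&` W @^-1` A3) =
    P ((fun w => (X w, Y w)) @^-1` C) * P (W @^-1` A3).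
  move=> mC mA3; apply: indep_pair_event => //; first exact: measurable_preimage.
  by move=> A1 A2 mA1 mA2; rewrite H3// HXY.
have HW4 C A3 : measurable C -> measurable A3 ->
    P ((fun w => (X w, Y w)) @^-1` C `&` W @^-1` A3 `&` B) =
    P ((fun w => (X w, Y w)) @^-1` C) * P (W @^-1` A3) * P B.
  move=> mC mA3.
  have PWB : P (W @^-1` A3 `&` B) = P (W @^-1` A3) * P B.
    have := H4 setT setT A3 measurableT measurableT mA3.
    by rewrite !preimage_setT !setTI probability_setT !mul1e.
  rewrite -setIA -muleA -PWB; apply: indep_pair_event => //.
    by apply: measurableI => //; exact: measurable_preimage.
  by move=> A1 A2 mA1 mA2; rewrite setIA H4// HXY// PWB muleA.
apply: (@indep_pair_event _ _ _ _ (fun w => (X w, Y w)) W B) => // C A3 mC mA3.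
by rewrite HW4// HW3.
Qed.

(** The product formula on boxes is upgraded one triple at a time: arbitrary events of the first
    triple against boxes of the second, then arbitrary events of both. *)
Lemma indep2_triple d1 d2 d3 d4 d5 d6 (T1 : measurableType d1)
    (T2 : measurableType d2) (T3 : measurableType d3) (T4 : measurableType d4)
    (T5 : measurableType d5) (T6 : measurableType d6) (X : Omega -> T1)
    (Y : Omega -> T2) (W : Omega -> T3) (X' : Omega -> T4)
    (Y' : Omega -> T5) (W' : Omega -> T6) :
  measurable_fun setT X -> measurable_fun setT Y -> measurable_fun setT W ->
  measurable_fun setT X' -> measurable_fun setT Y' -> measurable_fun setT W' ->
  (forall A1 A2 A3 A4 A5 A6, measurable A1 -> measurable A2 -> measurable A3 ->
    measurable A4 -> measurable A5 -> measurable A6 ->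
    P ((X @^-1` A1 `&` Y @^-1` A2 `&` W @^-1` A3) `&`
       (X' @^-1` A4 `&` Y' @^-1` A5 `&` W' @^-1` A6)) =
    (P (X @^-1` A1) * P (Y @^-1` A2) * P (W @^-1` A3)) *
    (P (X' @^-1` A4) * P (Y' @^-1` A5) * P (W' @^-1` A6))) ->
  indep2 (fun w => (X w, Y w, W w)) (fun w => (X' w, Y' w, W' w)).
Proof.
move=> mX mY mW mX' mY' mW' H6.
(* The marginal product formulas are the cases where the other three events are the whole space. *)
have H3 A1 A2 A3 : measurable A1 -> measurable A2 -> measurable A3 ->
    P (X @^-1` A1 `&` Y @^-1` A2 `&` W @^-1` A3) =
    P (X @^-1` A1) * P (Y @^-1` A2) * P (W @^-1` A3).
  move=> mA1 mA2 mA3.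
  have := H6 _ _ _ setT setT setT mA1 mA2 mA3 measurableT measurableT measurableT.
  by rewrite !preimage_setT !setIT probability_setT !mule1.
have H3' A1 A2 A3 : measurable A1 -> measurable A2 -> measurable A3 ->
    P (X' @^-1` A1 `&` Y' @^-1` A2 `&` W' @^-1` A3) =
    P (X' @^-1` A1) * P (Y' @^-1` A2) * P (W' @^-1` A3).
  move=> mA1 mA2 mA3.
  have := H6 setT setT setT _ _ _ measurableT measurableT measurableT mA1 mA2 mA3.
  by rewrite !preimage_setT !setIT !setTI probability_setT !mul1e.
have m3 d1' d2' d3' (U1 : measurableType d1') (U2 : measurableType d2')
    (U3 : measurableType d3') (f : Omega -> U1) (g : Omega -> U2)
    (h : Omega -> U3) A1 A2 A3 : measurable_fun setT f ->
    measurable_fun setT g -> measurable_fun setT h ->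
    measurable A1 -> measurable A2 -> measurable A3 ->
    measurable (f @^-1` A1 `&` g @^-1` A2 `&` h @^-1` A3).
  move=> mf mg mh mA1 mA2 mA3.
  by apply: measurableI; [apply: measurableI|]; exact: measurable_preimage.
move=> A A' mA mA'; rewrite setIC muleC.
have mU : measurable_fun setT (fun w => (X w, Y w, W w)).
  by apply: measurable_fun_pair => //; exact: measurable_fun_pair.
apply: indep_triple_event => //; first exact: measurable_preimage.
move=> A4 A5 A6 mA4 mA5 mA6; rewrite setIC [RHS]muleC -H3'//.
apply: indep_triple_event => //; first exact: m3.
by move=> A1 A2 A3 mA1 mA2 mA3; rewrite H6// H3'.
Qed.

End Independence.

Section MutualIndependence.
Context {d : measure_display} {Omega : measurableType d} {R : realType}.
Variable P : probability Omega R.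
Local Open Scope ereal_scope.

Lemma sigma_of_preimage d' (T : measurableType d') (X : Omega -> T) A :
  measurable A -> sigma_of X (X @^-1` A).
Proof. by move=> mA; exists A => //; rewrite setTI. Qed.

(** Mutual independence speaks of families of events indexed by [I]. Events listed along a
    duplicate-free list of indices form such a family through [index], which avoids case analysis on
    [I] when it is applied. *)
Lemma mutually_independent_seq (I : choiceType) (E : I -> set (set Omega))
    (i0 : I) (s : seq I) (B : seq (set Omega)) :
  mutually_independent P E -> uniq s -> size B = size s ->
  (forall k, (k < size s)%N -> E (nth i0 s k) (nth setT B k)) ->
  P (\big[setI/setT]_(X <- B) X) = \prod_(X <- B) P X.
Proof.
move=> indepE us sB EB.
pose A i := nth setT B (index i s).
have <- : [seq A i | i <- s] = B.
  apply: (@eq_from_nth _ setT) => [|k]; rewrite size_map// => ks.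
  by rewrite (nth_map i0)// /A index_uniq.
rewrite !big_map -bigcap_seq; apply: indepE => // i si.
by rewrite /A -{1}(nth_index i0 si); apply: EB; rewrite index_mem.
Qed.

End MutualIndependence.

(** * Noisy evaluations *)

Section AverageVariance.
Context {d : measure_display} {Omega : measurableType d} {R : realType}.
Variable P : probability Omega R.
Local Open Scope ereal_scope.

Lemma Lfun1_cst (k : R) : (fun _ : Omega => k) \in Lfun P 1.
Proof. exact: Lfun_cst. Qed.

(** Centering at the mean subtracts [a ^+ 2] from the second moment, so a bound on the latter
    survives. *)
Lemma expectation_shift_le (X : Omega -> R) (a K : R) :
  measurable_fun setT X -> 'E_P[X] = a%:E ->
  'E_P[fun w => X w ^+ 2]%R <= K%:E ->
  (fun w => (X w - a) ^+ 2)%R \in Lfun P 1 /\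
  'E_P[fun w => (X w - a) ^+ 2]%R <= K%:E.
Proof.
move=> mX EX X2K.
have X2 : (fun w => X w ^+ 2)%R \in Lfun P 1.
  apply: Lfun1_ge0 X2K; first exact: measurable_funX.
  by move=> w; exact: sqr_ge0.
have X1 := Lfun1_sqr mX X2.
have Y1 : (fun w => (- (2 * a)) * X w + a ^+ 2)%R \in Lfun P 1.
  by apply: rpredD; [exact: Lfun1Z|exact: Lfun1_cst].
have -> : (fun w => (X w - a) ^+ 2)%R =
    ((fun w => X w ^+ 2) \+ (fun w => (- (2 * a)) * X w + a ^+ 2))%R.
  by apply/funext => w /=; ring.
split; first exact: rpredD.
have EY : 'E_P[fun w => (- (2 * a)) * X w + a ^+ 2]%R = (- a ^+ 2)%:E.
  rewrite (@expectationD _ _ _ _ (fun w => - (2 * a) * X w)%R (cst (a ^+ 2)%R));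
    [|exact: Lfun1Z|exact: Lfun1_cst].
  rewrite expectationZr// EX expectation_cst -EFinM -EFinD.
  by congr EFin; ring.
rewrite expectationD// EY (le_trans _ X2K)// -[leRHS]adde0 leeD2l// lee_fin.
by rewrite oppr_le0 sqr_ge0.
Qed.

Lemma average_variance_le (N : nat) (V : 'I_N -> Omega -> R) (a K : R) :
  (0 < N)%N ->
  (forall j, measurable_fun setT (V j)) ->
  (forall j, 'E_P[V j] = a%:E) ->
  (forall j, 'E_P[fun w => V j w ^+ 2]%R <= K%:E) ->
  (forall j k, j != k -> indep2 P (V j) (V k)) ->
  (fun w => (N%:R^-1 * \sum_j V j w - a) ^+ 2)%R \in Lfun P 1 /\
  'E_P[fun w => (N%:R^-1 * \sum_j V j w - a) ^+ 2]%R <= (K / N%:R)%:E.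
Proof.
move=> N0 mV EV V2 indepV.
have NR0 : (N%:R != 0 :> R)%R by rewrite pnatr_eq0 -lt0n.
pose U j w := (V j w - a)%R.
have mU j : measurable_fun setT (U j) by exact: measurable_funB.
have U2 j := expectation_shift_le (mV j) (EV j) (V2 j).
have UU j k : (fun w => U j w * U k w)%R \in Lfun P 1.
  by apply: Lfun1_mul => //; [case: (U2 j)|case: (U2 k)].
have EU j : 'E_P[U j] = 0.
  have V1 : V j \in Lfun P 1.
    apply: Lfun1_sqr => //; apply: Lfun1_ge0 (V2 j); first exact: measurable_funX.
    by move=> w; exact: sqr_ge0.
  rewrite (@expectationB _ _ _ _ (V j) (cst a))//; last exact: Lfun1_cst.
  by rewrite EV expectation_cst subee.
(* With [V j] frozen, the product has mean a constant times [E[U k] = 0]. *)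
have EUU j k : j != k -> 'E_P[fun w => U j w * U k w]%R = 0.
  move=> jk; pose F (z : R * R) := ((z.1 - a) * (z.2 - a))%R.
  apply: (@indep2_expectation0 _ _ _ _ _ _ _ _ _ _ (mV j) (mV k) (indepV _ _ jk) F).
  - by apply: measurable_funM; exact: measurable_funB.
  - exact: UU.
  - move=> w; rewrite /F /= (@expectationZr _ _ _ _ (U k)) ?EU ?mule0//.
    by apply: Lfun1_sqr => //; case: (U2 k).
have -> : (fun w => (N%:R^-1 * \sum_j V j w - a) ^+ 2)%R =
    (fun w => N%:R ^- 2 * \sum_j \sum_k U j w * U k w)%R.
  apply/funext => w.
  have <- : ((\sum_j U j w) * (\sum_k U k w) = \sum_j \sum_k U j w * U k w)%R.
    by rewrite big_distrlr.
  by rewrite /U sumrB sumr_const card_ord -mulr_natr; field.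
have UUk j : (fun w => \sum_k U j w * U k w)%R \in Lfun P 1.
  by apply: Lfun1_sum => k; exact: UU.
split; first by apply: Lfun1Z; exact: Lfun1_sum.
rewrite expectationZr; last exact: Lfun1_sum.
rewrite expectation_sumr//.
have -> : (K / N%:R)%:E = (N%:R ^- 2)%:E * \sum_(j < N) K%:E.
  rewrite sumEFin -EFinM sumr_const card_ord -mulr_natr; congr EFin.
  by field.
rewrite lee_pmul2l// ?lte_fin ?invr_gt0 ?exprn_gt0 ?ltr0n//.
apply: lee_sum => j _; rewrite expectation_sumr// (bigD1 j)//= big1; last first.
  by move=> k kj; apply: EUU; rewrite eq_sym.
by rewrite adde0; case: (U2 j).
Qed.

End AverageVariance.

(** * Noise of an evaluation at a random point *)

Section EvaluationNoise.
Context {d : measure_display} {Omega : measurableType d} {R : realType}.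
Variable P : probability Omega R.
Context {n : nat} {Z : 'cV[R]_n -> R} {sigma : R} {d' : measure_display}
  {T : measurableType d'} {zeta : 'cV[R]_n -> T -> R} {xi : Omega -> T}.
Hypothesis noisy : noisy_evaluation P Z sigma zeta xi.
Hypothesis cZ : {within simplex n, continuous Z}.
Local Open Scope ereal_scope.

Let mS : measurable (simplex n `*` setT : set (borel_cV R n * T)%type).
Proof. by apply: measurableX => //; exact: measurable_simplex. Qed.

Lemma noisy_measurable y : simplex n y -> measurable_fun setT (fun w => zeta y (xi w)).
Proof.
move=> sy; have [mxi mz _ _] := noisy.
apply: (measurable_comp mS _ mz (_ : measurable_fun setT
  (fun w => (y, xi w) : (borel_cV R n * T)%type))).
  by move=> _ [w _ <-].
exact: measurable_fun_pair.
Qed.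

Lemma noisy_sqr_le y : simplex n y ->
  'E_P[fun w => (zeta y (xi w) - Z y) ^+ 2]%R <= (sigma ^+ 2)%:E.
Proof.
move=> sy; have [_ _ /(_ y sy) EZ /(_ y sy)] := noisy.
rewrite /variance unlock EZ/=; congr (_ <= _); congr expectation.
Qed.

Lemma noisy_sqr_Lfun1 y : simplex n y ->
  (fun w => (zeta y (xi w) - Z y) ^+ 2)%R \in Lfun P 1.
Proof.
move=> sy; apply: Lfun1_ge0 (noisy_sqr_le sy).
  by apply: measurable_funX; apply: measurable_funB => //; exact: noisy_measurable.
by move=> w; exact: sqr_ge0.
Qed.

Lemma noisy_mean0 y : simplex n y ->
  (fun w => zeta y (xi w) - Z y)%R \in Lfun P 1 /\
  'E_P[fun w => zeta y (xi w) - Z y]%R = 0.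
Proof.
move=> sy; have [_ _ /(_ y sy) EZ _] := noisy.
have X1 : (fun w => zeta y (xi w) - Z y)%R \in Lfun P 1.
  apply: Lfun1_sqr (noisy_sqr_Lfun1 sy).
  by apply: measurable_funB => //; exact: noisy_measurable.
split=> //.
have Y1 : (fun w => zeta y (xi w)) \in Lfun P 1.
  rewrite (_ : (fun w => _) = (fun w => zeta y (xi w) - Z y) \+ cst (Z y))%R.
    by apply: rpredD => //; exact: Lfun1_cst.
  by apply/funext => w /=; rewrite subrK.
rewrite (@expectationB _ _ _ _ (fun w => zeta y (xi w)) (cst (Z y)))//.
  by rewrite EZ expectation_cst subee.
exact: Lfun1_cst.
Qed.

(** The evaluation point as a function of the direction: later [mix] for the perturbed evaluation
    and the constant [p] for the base one. *)
Variable q : 'cV[R]_n -> 'cV[R]_n.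
Hypothesis mq : measurable_fun setT (q : borel_cV R n -> borel_cV R n).
Hypothesis sq : forall x, simplex n x -> simplex n (q x).

(* Set to [0] off the simplex, where nothing is known about [zeta]. *)
Definition noise : borel_cV R n * T -> R :=
  (fun z => zeta (q z.1) z.2 - Z (q z.1))%R \_ (simplex n `*` setT).

Lemma noiseE x t : simplex n x -> noise (x, t) = (zeta (q x) t - Z (q x))%R.
Proof. by move=> sx; rewrite /noise patchE mem_set. Qed.

Lemma noise_out x t : ~ simplex n x -> noise (x, t) = 0%R.
Proof. by move=> sx; rewrite /noise patchE memNset// => -[]. Qed.

Lemma measurable_noise : measurable_fun setT noise.
Proof.
have [_ mz _ _] := noisy.
apply/(measurable_restrict _ mS measurableT); rewrite setTI.
have mqS : measurable_fun (simplex n `*` setT : set (borel_cV R n * T)%type)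
    (fun z => (q z.1, z.2) : (borel_cV R n * T)%type).
  apply: measurable_funTS; apply: measurable_fun_pair => //.
  exact: measurableT_comp mq measurable_fst.
apply: measurable_funB.
  apply: (measurable_comp mS _ mz mqS) => _ [[x t] [/= sx _] <-].
  by split => //; exact: sq.
apply: (measurable_comp measurable_simplex _ (within_simplex_measurable cZ)
  (_ : measurable_fun _ (fun z : (borel_cV R n * T)%type => (q z.1 : borel_cV R n)))).
  by move=> _ [[x t] [/= sx _] <-]; exact: sq.
by apply: measurable_funTS; exact: measurableT_comp mq measurable_fst.
Qed.

Lemma noise_section_le (a : R) x :
  'E_P[fun w => (a * noise (x, xi w)) ^+ 2]%R <= (sigma ^+ 2 * a ^+ 2)%:E.
Proof.
have [sx|sx] := pselect (simplex n x); last first.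
  under [X in 'E_P[X]]eq_fun do rewrite noise_out// mulr0 expr0n.
  by rewrite expectation_cst lee_fin mulr_ge0 ?sqr_ge0.
under [X in 'E_P[X]]eq_fun do rewrite noiseE// exprMn.
rewrite expectationZr; last exact/noisy_sqr_Lfun1/sq.
rewrite [(sigma ^+ 2 * _)%R]mulrC [leRHS]EFinM.
apply: lee_wpmul2l; first by rewrite lee_fin sqr_ge0.
exact/noisy_sqr_le/sq.
Qed.

Lemma noise_section_mean0 (a : R) x : 'E_P[fun w => a * noise (x, xi w)]%R = 0.
Proof.
have [sx|sx] := pselect (simplex n x); last first.
  under [X in 'E_P[X]]eq_fun do rewrite noise_out// mulr0.
  by rewrite expectation_cst.
under [X in 'E_P[X]]eq_fun do rewrite noiseE//.
have [X1 EX] := noisy_mean0 (sq sx).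
by rewrite expectationZr// EX mule0.
Qed.

Variables (D : Omega -> 'cV[R]_n) (a : 'cV[R]_n -> R).
Hypothesis mD : measurable_fun setT (D : Omega -> borel_cV R n).
Hypothesis ma : measurable_fun setT (a : borel_cV R n -> R).
Hypothesis indepD : indep2 P (D : Omega -> borel_cV R n) xi.

Lemma noise_sqr_le :
  'E_P[fun w => (a (D w) * noise (D w, xi w)) ^+ 2]%R <=
  'E_P[fun w => sigma ^+ 2 * a (D w) ^+ 2]%R.
Proof.
have [mxi _ _ _] := noisy.
pose F (z : (borel_cV R n * T)%type) := ((a z.1 * noise z) ^+ 2)%R.
apply: (@indep2_expectation_le _ _ _ _ _ _ _ _ _ _ mD mxi indepD F).
- apply: measurable_funX; apply: measurable_funM; last exact: measurable_noise.
  exact: measurableT_comp ma measurable_fst.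
- by move=> z; exact: sqr_ge0.
- apply: measurable_funM => //; apply: measurable_funX.
  exact: measurableT_comp ma mD.
- by move=> w; exact: (noise_section_le (a (D w)) (D w)).
Qed.

Lemma measurable_weighted_noise :
  measurable_fun setT (fun w => a (D w) * noise (D w, xi w))%R.
Proof.
have [mxi _ _ _] := noisy.
apply: measurable_funM; first exact: measurableT_comp ma mD.
by apply: measurableT_comp measurable_noise _; exact: measurable_fun_pair.
Qed.

Lemma noise_mean0 : (fun w => a (D w) ^+ 2)%R \in Lfun P 1 ->
  [/\ (fun w => (a (D w) * noise (D w, xi w)) ^+ 2)%R \in Lfun P 1,
    (fun w => a (D w) * noise (D w, xi w))%R \in Lfun P 1 &
    'E_P[fun w => a (D w) * noise (D w, xi w)]%R = 0].
Proof.
move=> a2; have [mxi _ _ _] := noisy.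
have [k Ek] := expectation_real (Lfun1Z (sigma ^+ 2) a2).
have X2 : (fun w => (a (D w) * noise (D w, xi w)) ^+ 2)%R \in Lfun P 1.
  apply: (@Lfun1_ge0 _ _ _ _ _ k) => [|w|]; last by rewrite -Ek noise_sqr_le.
  - by apply: measurable_funX; exact: measurable_weighted_noise.
  - exact: sqr_ge0.
have X1 := Lfun1_sqr measurable_weighted_noise X2; split => //.
pose F (z : (borel_cV R n * T)%type) := (a z.1 * noise z)%R.
apply: (@indep2_expectation0 _ _ _ _ _ _ _ _ _ _ mD mxi indepD F) => //.
- apply: measurable_funM; last exact: measurable_noise.
  exact: measurableT_comp ma measurable_fst.
- by move=> w; exact: (noise_section_mean0 (a (D w)) (D w)).
Qed.

End EvaluationNoise.

(** * The estimator *)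

Section MonteCarloDirections.
Context {d : measure_display} {Omega : measurableType d} {R : realType}.
Variable P : probability Omega R.
Context {n : nat}.
Variables (p : 'cV[R]_n) (gamma : R) (delta : Omega -> 'cV[R]_n).
Hypothesis n2 : (2 <= n)%N.
Hypothesis sp : simplex n p.
Hypothesis mdelta : measurable_fun setT (delta : Omega -> borel_cV R n).
Hypothesis sdelta : forall w, simplex n (delta w).

Lemma measurable_coordB k : measurable_fun setT (fun w => (delta w - p) k 0).
Proof.
rewrite (_ : (fun w => _) = (fun w => delta w k 0 - p k 0)%R); last first.
  by apply/funext => w; rewrite !mxE.
apply: measurable_funB => //.
have mk : measurable_fun setT ((fun x : 'cV[R]_n => x k 0) : borel_cV R n -> R).
  by apply: continuous_measurable_cV; exact: coord_continuous.
exact: measurableT_comp mk mdelta.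
Qed.

Lemma coordB_le2 k w : (`|(delta w - p) k 0| <= 2)%R.
Proof. exact: le_trans (coord_le_enorm _ _) (enorm_simplex_le2 (sdelta w) sp). Qed.

Lemma Lfun1_bounded_coord (r : Omega -> R) (K : R) k :
  measurable_fun setT r -> (forall w, `|r w| <= K)%R ->
  (fun w => gamma * r w * (delta w - p) k 0)%R \in Lfun P 1.
Proof.
move=> mr rK; apply: (@Lfun1_bounded _ _ _ _ _ (`|gamma| * K * 2)%R).
  apply: measurable_funM; last exact: measurable_coordB.
  exact: measurable_funM.
move=> w; rewrite !normrM ler_pM//; last exact: coordB_le2.
by rewrite ler_wpM2l.
Qed.

Lemma measurable_dotB (g : 'cV[R]_n) :
  measurable_fun setT (fun w => dot g (delta w - p)).
Proof.
under eq_fun do rewrite dotE.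
apply: measurable_sum => i; apply: measurable_funM => //.
exact: measurable_coordB.
Qed.

Lemma measurable_quadB (H : 'M[R]_n) :
  measurable_fun setT (fun w => dot (delta w - p) (H *m (delta w - p))).
Proof.
under eq_fun do rewrite dotE.
apply: measurable_sum => i; apply: measurable_funM; first exact: measurable_coordB.
by under eq_fun do rewrite mulmx_row; exact: measurable_dotB.
Qed.

Variable lambda : R.
Hypothesis MC2 : has_mean P (fun w => (delta w - p) *m (Sffe gamma p (delta w))^T)
  (1%:M - lambda *: (ones n *m (ones n)^T)).

Local Open Scope ereal_scope.

Let n0 : (n%:R != 0 :> R)%R.
Proof. by rewrite pnatr_eq0 -lt0n (ltn_trans _ n2). Qed.

Lemma expectation_coordBM i k :
  'E_P[fun w => gamma * (delta w - p) i 0 * (delta w - p) k 0]%R =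
    ((i == k)%:R - lambda)%:E.
Proof.
have -> : ((i == k)%:R - lambda)%R =
    ((1%:M - lambda *: (ones n *m (ones n)^T)) i k)%R.
  by rewrite !mxE zmodp.big_ord1 !mxE !mulr1.
rewrite -MC2; congr expectation; apply/funext => w.
by rewrite [RHS]mxE zmodp.big_ord1 !mxE; ring.
Qed.

Lemma Lfun1_coordBM i k :
  (fun w => gamma * (delta w - p) i 0 * (delta w - p) k 0)%R \in Lfun P 1.
Proof.
exact: Lfun1_bounded_coord (measurable_coordB i) (coordB_le2 i).
Qed.

(* The rows of [I - lambda 1 1'] sum to [0], because [1' (delta - p) = 0]. *)
Lemma lambdaE : lambda = n%:R^-1%R.
Proof.
have [k _] : exists k : 'I_n, true by exists (Ordinal n2).
have : 'E_P[fun w => \sum_i gamma * (delta w - p) i 0 * (delta w - p) k 0]%R = 0.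
  transitivity ('E_P[cst 0]%R); last exact: expectation_cst.
  congr expectation; apply/funext => w /=.
  by rewrite -mulr_suml -mulr_sumr sum_simplexB// mulr0 mul0r.
rewrite expectation_sumr; last by move=> i; exact: Lfun1_coordBM.
under eq_bigr do rewrite expectation_coordBM.
rewrite sumEFin => -[]; rewrite sumrB sumr_const card_ord.
rewrite (bigD1 k)//= eqxx big1 ?addr0 => [/eqP|i /negbTE -> //].
by rewrite subr_eq0 => /eqP l1; apply: (mulIf n0); rewrite mulr_natr -l1 mulVf.
Qed.

Lemma gamma_sqr_enormE : (fun w => gamma * enorm (delta w - p) ^+ 2)%R =
  (fun w => \sum_i gamma * (delta w - p) i 0 * (delta w - p) i 0)%R.
Proof.
apply/funext => w; rewrite sqr_enorm dotE mulr_sumr.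
by apply: eq_bigr => i _; rewrite mulrA.
Qed.

Lemma Lfun1_enormB :
  (fun w => gamma * enorm (delta w - p) ^+ 2)%R \in Lfun P 1.
Proof.
by rewrite gamma_sqr_enormE; apply: Lfun1_sum => i; exact: Lfun1_coordBM.
Qed.

Lemma expectation_enormB :
  'E_P[fun w => gamma * enorm (delta w - p) ^+ 2]%R = (n%:R - 1)%:E.
Proof.
rewrite gamma_sqr_enormE expectation_sumr; last by move=> i; exact: Lfun1_coordBM.
under eq_bigr do rewrite expectation_coordBM eqxx.
rewrite lambdaE.
by rewrite sumEFin sumr_const card_ord mulrnBl -[(_^-1 *+ _)%R]mulr_natr mulVf.
Qed.

(** Otherwise [gamma * enorm (delta w - p) ^+ 2] would be nonpositive, although its mean [n - 1] is
    positive. *)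
Lemma gamma_gt0 : (0 < gamma)%R.
Proof.
rewrite ltNge; apply/negP => g0.
have : 0 <= 'E_P[fun w => - 1 * (gamma * enorm (delta w - p) ^+ 2)]%R.
  by apply: expectation_ge0 => w; rewrite mulN1r oppr_ge0 mulr_le0_ge0// sqr_ge0.
rewrite expectationZr ?Lfun1_enormB// expectation_enormB -EFinM lee_fin mulN1r.
by rewrite oppr_ge0 subr_le0 leNgt ltr1n n2.
Qed.

(** With [lambda = 1 / n], the matrix in (MC2) is the orthogonal projection off the all-ones
    direction; the part of [g] that it removes is the origin of the term [- dot g (ones n) / n] in
    [eps0]. *)
Lemma expectation_dotBM (g : 'cV[R]_n) k :
  'E_P[fun w => gamma * dot g (delta w - p) * (delta w - p) k 0]%R =
    (g k 0 - dot g (ones n) / n%:R)%:E.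
Proof.
transitivity ('E_P[fun w => \sum_i
    g i 0 * (gamma * (delta w - p) i 0 * (delta w - p) k 0)]%R).
  congr expectation; apply/funext => w; rewrite dotE mulr_sumr mulr_suml.
  by apply: eq_bigr => i _; ring.
rewrite expectation_sumr; last by move=> i; apply: Lfun1Z; exact: Lfun1_coordBM.
under eq_bigr do rewrite expectationZr ?Lfun1_coordBM// expectation_coordBM -EFinM.
rewrite sumEFin lambdaE; congr EFin; under eq_bigr do rewrite mulrBr.
rewrite sumrB -mulr_suml (bigD1 k)//= eqxx mulr1 big1 ?addr0; last first.
  by move=> i /negbTE ->; rewrite mulr0.
rewrite dotE; congr (_ - _ / _)%R; apply: eq_bigr => i _.
by rewrite mxE mulr1.
Qed.

(* Testing the vector [E[r S]] against itself turns the norm of an expectation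
   into the expectation of [r S' v], to which Cauchy-Schwarz applies. *)
Lemma enorm_expectation_le (r : Omega -> R) (K : R) (v : 'cV[R]_n) :
  measurable_fun setT r -> (0 <= K)%R ->
  (forall w, `|r w| <= K * enorm (delta w - p))%R ->
  (forall k, 'E_P[fun w => gamma * r w * (delta w - p) k 0]%R = (v k 0)%:E) ->
  (enorm v <= n%:R * K)%R.
Proof.
move=> mr K0 rK Ev.
have rK2 w : (`|r w| <= K * 2)%R.
  by rewrite (le_trans (rK w))// ler_wpM2l// enorm_simplex_le2.
have X1 k := Lfun1_bounded_coord k mr rK2.
have E2 : 'E_P[fun w => gamma * r w * dot v (delta w - p)]%R = (enorm v ^+ 2)%:E.
  transitivity ('E_P[fun w => \sum_k
      v k 0 * (gamma * r w * (delta w - p) k 0)]%R).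
    congr expectation; apply/funext => w; rewrite dotE mulr_sumr.
    by apply: eq_bigr => k _; ring.
  rewrite expectation_sumr; last by move=> k; exact: Lfun1Z.
  under eq_bigr do rewrite expectationZr// Ev -EFinM.
  by rewrite sumEFin sqr_enorm dotE.
have g0 := gamma_gt0.
have me : measurable_fun setT (fun w => enorm (delta w - p) ^+ 2)%R.
  under eq_fun do rewrite sqr_enorm dotE.
  by apply: measurable_sum => i; apply: measurable_funM; exact: measurable_coordB.
have mrv : measurable_fun setT (fun w => gamma * r w * dot v (delta w - p))%R.
  by apply: measurable_funM; [exact: measurable_funM|exact: measurable_dotB].
have irv : (fun w => gamma * r w * dot v (delta w - p))%R \in Lfun P 1.
  apply: (Lfun1_bounded _ (K := (gamma * (K * 2) * (enorm v * 2))%R)) => // w.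
  rewrite !normrM (gtr0_norm g0) ler_pM ?mulr_ge0 ?(ltW g0)//.
    by rewrite ler_wpM2l// ltW.
  rewrite (le_trans (dot_le _ _))// ler_wpM2l ?enorm_ge0//.
  exact: enorm_simplex_le2.
(* [r] and [dot v (delta w - p)] each contribute one factor [enorm (delta w - p)]; times [gamma]
   their product has mean [n - 1]. *)
have : (enorm v ^+ 2)%:E <= (K * enorm v * (n%:R - 1))%:E.
  rewrite -E2 EFinM -expectation_enormB -expectationZr ?Lfun1_enormB//.
  apply: (@le_trans _ _ 'E_P[fun w => `|gamma * r w * dot v (delta w - p)|%R]).
    rewrite unlock; apply: le_integral => //.
    - exact/Lfun1_integrable.
    - exact/Lfun1_integrable/Lfun_norm.
    - by move=> w _; rewrite lee_fin ler_norm.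
  apply: expectation_ge0_le.
  - exact: measurableT_comp.
  - by apply: measurable_funM => //; exact: measurable_funM.
  move=> w; rewrite normr_ge0/= !normrM (gtr0_norm g0).
  have -> : (K * enorm v * (gamma * enorm (delta w - p) ^+ 2) =
    gamma * (K * enorm (delta w - p)) * (enorm v * enorm (delta w - p)))%R by ring.
  rewrite ler_pM ?mulr_ge0 ?(ltW g0)//; last exact: dot_le.
  by rewrite ler_wpM2l// ltW.
rewrite lee_fin => le2.
have := enorm_ge0 v; rewrite le_eqVlt => /predU1P[<-|v0]; first exact: mulr_ge0.
rewrite -(ler_pM2r v0) -expr2 (le_trans le2)//.
have := mulr_ge0 K0 (enorm_ge0 v); lra.
Qed.

End MonteCarloDirections.

(** * Mean and second moment of one replication *)

Section Replication.
Context {d : measure_display} {Omega : measurableType d} {R : realType}.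
Variable P : probability Omega R.
Context {n : nat} {Z : 'cV[R]_n -> R} {sigma : R}.
Context {d1 d2 : measure_display} {T1 : measurableType d1} {T2 : measurableType d2}.
Variables (zeta1 : 'cV[R]_n -> T1 -> R) (xi1 : Omega -> T1).
Variables (zeta2 : 'cV[R]_n -> T2 -> R) (xi2 : Omega -> T2).
Variables (p : 'cV[R]_n) (c gamma M : R) (D : Omega -> 'cV[R]_n).
Hypothesis noisy1 : noisy_evaluation P Z sigma zeta1 xi1.
Hypothesis noisy2 : noisy_evaluation P Z sigma zeta2 xi2.
Hypothesis Z2 : sC 2 Z.
Hypothesis ZM : forall q, simplex n q -> enorm (sgrad Z q) <= M.
Hypothesis sp : simplex n p.
Hypothesis c01 : 0 < c <= 1.
Hypothesis g0 : 0 < gamma.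
Hypothesis mD : measurable_fun setT (D : Omega -> borel_cV R n).
Hypothesis sD : forall w, simplex n (D w).

Let c0 : 0 < c. Proof. by case/andP: c01. Qed.
Let cneq0 : c != 0. Proof. by rewrite gt_eqF. Qed.
Let c1 : 0 <= c <= 1. Proof. by case/andP: c01 => /ltW -> ->. Qed.
Let cZ : {within simplex n, continuous Z}. Proof. by case: Z2. Qed.

Definition mix (x : 'cV[R]_n) : 'cV[R]_n := (1 - c) *: p + c *: x.

Lemma mixE x : mix x = p + c *: (x - p).
Proof. by rewrite /mix scalerBl scale1r scalerBr addrAC addrA. Qed.

Lemma mix_simplex x : simplex n x -> simplex n (mix x).
Proof. by move=> sx; rewrite mixE; exact: simplex_segment. Qed.

Lemma measurable_mix : measurable_fun setT (mix : borel_cV R n -> borel_cV R n).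
Proof.
apply: (@continuous_measurable_cV_cV _ _ mix) => x.
have cc : continuous (fun _ : 'cV[R]_n => (1 - c) *: p) by exact: cst_continuous.
have cs : continuous (fun y : 'cV[R]_n => c *: y) by exact: scaler_continuous.
exact: continuousD (cc x) (cs x).
Qed.

Lemma measurable_coord_subr k :
  measurable_fun setT ((fun x => (x - p) k 0) : borel_cV R n -> R).
Proof.
apply: (@continuous_measurable_cV _ _ (fun x => (x - p) k 0)) => x.
have cc : continuous (fun _ : 'cV[R]_n => (- p) k 0) by exact: cst_continuous.
have ck : continuous (fun y : 'cV[R]_n => y k 0) by exact: coord_continuous.
under eq_fun do rewrite mxE.
exact: continuousD (ck x) (cc x).
Qed.

(** Cut off to 0 outside the simplex, like [noise], so that continuity of [Z] on the simplex yields
    measurability on the whole space. *)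
Definition scaled_increment : 'cV[R]_n -> R :=
  (fun x => (Z (mix x) - Z p) / c) \_ (simplex n).

Lemma scaled_incrementE x : simplex n x ->
  scaled_increment x = (Z (mix x) - Z p) / c.
Proof. by move=> sx; rewrite /scaled_increment patchE mem_set. Qed.

Lemma measurable_scaled_increment :
  measurable_fun setT (scaled_increment : borel_cV R n -> R).
Proof.
apply/(measurable_restrict _ measurable_simplex measurableT); rewrite setTI.
apply: measurable_funM => //; apply: measurable_funB => //.
apply: (measurable_comp measurable_simplex _ (within_simplex_measurable cZ)
  (measurable_funTS measurable_mix)).
by move=> _ [x sx <-]; exact: mix_simplex.
Qed.

Lemma scaled_increment_le x : simplex n x ->
  `|scaled_increment x| <= M * enorm (x - p).
Proof.
move=> sx; rewrite scaled_incrementE// mixE normrM normfV (gtr0_norm c0).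
by rewrite ler_pdivrMr// mulrC mulrA; exact: increment_le.
Qed.

Lemma scaled_increment_le2 x : simplex n x -> `|scaled_increment x| <= M * 2.
Proof.
move=> sx; apply: le_trans (scaled_increment_le sx) _.
rewrite ler_wpM2l ?enorm_simplex_le2//.
exact: le_trans (enorm_ge0 _) (ZM sp).
Qed.

(** The conditional mean, given the direction [x], of coordinate [k] of one replication. *)
Definition ffe_signal k (x : 'cV[R]_n) : R :=
  gamma * scaled_increment x * (x - p) k 0.

Definition ffe_weight k (x : 'cV[R]_n) : R := gamma / c * (x - p) k 0.

Lemma measurable_ffe_signal k :
  measurable_fun setT (ffe_signal k : borel_cV R n -> R).
Proof.
apply: measurable_funM; last exact: measurable_coord_subr.
by apply: measurable_funM => //; exact: measurable_scaled_increment.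
Qed.

Lemma measurable_ffe_weight k :
  measurable_fun setT (ffe_weight k : borel_cV R n -> R).
Proof. by apply: measurable_funM => //; exact: measurable_coord_subr. Qed.

Let noise1 := @noise R n Z d1 T1 zeta1 mix.
Let noise2 := @noise R n Z d2 T2 zeta2 (fun _ => p).

(** One fixed measurable function of the triple (direction, first noise, second noise), so that
    independence of the triples passes to the replications by composition. *)
Definition replication k (z : borel_cV R n * T1 * T2) : R :=
  ffe_signal k z.1.1 + (ffe_weight k z.1.1 * noise1 z.1
    - ffe_weight k z.1.1 * noise2 (z.1.1, z.2)).

Lemma replicationE k w : replication k (D w, xi1 w, xi2 w) =
  (zeta1 (mix (D w)) (xi1 w) - zeta2 p (xi2 w)) / c * (gamma * (D w - p) k 0).
Proof.
rewrite /replication/= /noise1 /noise2 !noiseE// /ffe_signal /ffe_weight.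
rewrite scaled_incrementE//; field.
exact: cneq0.
Qed.

Let mp : measurable_fun setT ((fun _ => p) : borel_cV R n -> borel_cV R n).
Proof. exact: measurable_cst. Qed.

Lemma measurable_replication k : measurable_fun setT (replication k).
Proof.
have m11 : measurable_fun setT (fun z : (borel_cV R n * T1 * T2)%type => z.1.1).
  exact: measurableT_comp measurable_fst measurable_fst.
have mw := measurableT_comp (measurable_ffe_weight k) m11.
apply: measurable_funD.
  exact: measurableT_comp (measurable_ffe_signal k) m11.
apply: measurable_funB; apply: measurable_funM => //.
  apply: measurableT_comp measurable_fst.
  exact: (measurable_noise noisy1 cZ measurable_mix mix_simplex).
apply: (measurableT_comp (measurable_noise noisy2 cZ mp (fun _ _ => sp))).
by apply: measurable_fun_pair => //; exact: measurable_snd.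
Qed.

Hypothesis indep1 : indep2 P (D : Omega -> borel_cV R n) xi1.
Hypothesis indep2' : indep2 P (D : Omega -> borel_cV R n) xi2.
Local Open Scope ereal_scope.

Let Lfun1_weight k : (fun w => ffe_weight k (D w) ^+ 2)%R \in Lfun P 1.
Proof.
apply: (@Lfun1_bounded _ _ _ _ _ ((gamma / c * 2) ^+ 2)%R).
  apply: measurable_funX; exact: measurableT_comp (measurable_ffe_weight k) mD.
move=> w; rewrite normrX ler_pXn2r ?nnegrE ?mulr_ge0 ?invr_ge0 ?(ltW g0) ?(ltW c0)//.
rewrite /ffe_weight normrM (gtr0_norm (divr_gt0 g0 c0)).
rewrite ler_wpM2l ?divr_ge0 ?(ltW g0) ?(ltW c0)//.
exact: coordB_le2.
Qed.

Let X1 k w := (ffe_weight k (D w) * noise1 (D w, xi1 w))%R.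
Let X2 k w := (ffe_weight k (D w) * noise2 (D w, xi2 w))%R.
Let X1P k := noise_mean0 noisy1 cZ measurable_mix mix_simplex mD
  (measurable_ffe_weight k) indep1 (Lfun1_weight k).
Let X2P k := noise_mean0 noisy2 cZ mp (fun _ _ => sp) mD
  (measurable_ffe_weight k) indep2' (Lfun1_weight k).

Lemma Lfun1_ffe_signal k : (fun w => ffe_signal k (D w)) \in Lfun P 1.
Proof.
apply: (@Lfun1_bounded_coord _ _ _ P _ p gamma D sp mD sD
  (scaled_increment \o D) (M * 2)%R k).
  exact: measurableT_comp measurable_scaled_increment mD.
by move=> w; exact: scaled_increment_le2.
Qed.

Lemma expectation_replication k :
  'E_P[fun w => replication k (D w, xi1 w, xi2 w)] =
  'E_P[fun w => ffe_signal k (D w)].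
Proof.
have [_ i1 E1] := X1P k; have [_ i2 E2] := X2P k.
rewrite (@expectationD _ _ _ _ (fun w => ffe_signal k (D w)) (X1 k \- X2 k)%R);
  [|exact: Lfun1_ffe_signal|exact: rpredB].
by rewrite (@expectationB _ _ _ _ (X1 k) (X2 k))// E1 E2 subee// adde0.
Qed.

Lemma expectation_replication_sqr_le k (e : R) :
  'E_P[fun w => gamma * (D w - p) k 0 * (D w - p) k 0]%R = e%:E ->
  'E_P[fun w => replication k (D w, xi1 w, xi2 w) ^+ 2]%R <=
    (12 * (gamma / c ^+ 2) * (sigma ^+ 2 + c ^+ 2 * M ^+ 2) * e)%:E.
Proof.
move=> Ee.
have M0 : (0 <= M)%R by exact: le_trans (enorm_ge0 _) (ZM sp).
pose h w := (gamma * (D w - p) k 0 * (D w - p) k 0)%R.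
have h1 : h \in Lfun P 1.
  exact: (@Lfun1_bounded_coord _ _ _ P _ p gamma D sp mD sD
    (fun w => (D w - p) k 0)%R 2%R k (measurable_coordB p mD k)
    (coordB_le2 sp sD k)).
have h0 w : (0 <= h w)%R by rewrite /h -mulrA mulr_ge0 ?(ltW g0)// -expr2 sqr_ge0.
have [X11 _ _] := X1P k; have [X21 _ _] := X2P k.
(* One factor [gamma] is absorbed into [h], whose mean is the given [e]; the other stays outside,
   which makes the bound linear in [gamma]. *)
have wE : (fun w => sigma ^+ 2 * ffe_weight k (D w) ^+ 2)%R =
    (fun w => sigma ^+ 2 * (gamma / c ^+ 2) * h w)%R.
  by apply/funext => w; rewrite /ffe_weight /h; field.
have E1 : 'E_P[fun w => X1 k w ^+ 2]%R <= (sigma ^+ 2 * (gamma / c ^+ 2) * e)%:E.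
  rewrite [leRHS]EFinM -Ee -expectationZr// -wE.
  exact: (noise_sqr_le noisy1 cZ measurable_mix mix_simplex mD
    (measurable_ffe_weight k) indep1).
have E2 : 'E_P[fun w => X2 k w ^+ 2]%R <= (sigma ^+ 2 * (gamma / c ^+ 2) * e)%:E.
  rewrite [leRHS]EFinM -Ee -expectationZr// -wE.
  exact: (noise_sqr_le noisy2 cZ mp (fun _ _ => sp) mD
    (measurable_ffe_weight k) indep2').
(* The 3 comes from squaring a sum of three terms, the 4 from squaring the bound [M * 2] on the
   scaled increment. *)
pose Y w := (3 * (4 * M ^+ 2 * gamma) * h w + (3 * X1 k w ^+ 2 + 3 * X2 k w ^+ 2))%R.
have iN : (fun w => 3 * X1 k w ^+ 2 + 3 * X2 k w ^+ 2)%R \in Lfun P 1.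
  exact: (rpredD (Lfun1Z 3 X11) (Lfun1Z 3 X21)).
have iY : Y \in Lfun P 1 by exact: (rpredD (Lfun1Z _ h1) iN).
have mrep : measurable_fun setT (fun w => replication k (D w, xi1 w, xi2 w)).
  have [mxi1 _ _ _] := noisy1; have [mxi2 _ _ _] := noisy2.
  apply: measurableT_comp (measurable_replication k) _.
  by apply: measurable_fun_pair => //; exact: measurable_fun_pair.
apply: (@le_trans _ _ 'E_P[Y]).
  apply: expectation_ge0_le.
  - exact: measurable_funX.
  - exact: (Lfun1_measurable iY).
  move=> w; rewrite sqr_ge0/= /replication/= -/(X1 k w) -/(X2 k w).
  have : (ffe_signal k (D w) ^+ 2 <= 4 * M ^+ 2 * gamma * h w)%R.
    have -> : (4 * M ^+ 2 * gamma * h w = (M * 2) ^+ 2 * (gamma * (D w - p) k 0) ^+ 2)%R.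
      by rewrite /h; ring.
    have -> : (ffe_signal k (D w) ^+ 2 =
        scaled_increment (D w) ^+ 2 * (gamma * (D w - p) k 0) ^+ 2)%R.
      by rewrite /ffe_signal; ring.
    rewrite ler_wpM2r ?sqr_ge0// -[(scaled_increment _ ^+ 2)%R]real_normK ?num_real//.
    by rewrite ler_pXn2r ?nnegrE ?mulr_ge0// scaled_increment_le2.
  rewrite /Y; set s := ffe_signal _ _; set x := X1 k w; set y := X2 k w => sh.
  (* [3 (s^2 + x^2 + y^2) - (s + x - y)^2] is the sum of these three squares. *)
  have := sqr_ge0 (s - x); have := sqr_ge0 (s + y); have := sqr_ge0 (x + y).
  by rewrite !sqrrD !sqrrN; move: sh; lra.
rewrite (@expectationD _ _ _ _ (fun w => 3 * (4 * M ^+ 2 * gamma) * h w)%R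
  (fun w => 3 * X1 k w ^+ 2 + 3 * X2 k w ^+ 2)%R)//; last exact: Lfun1Z.
rewrite (@expectationD _ _ _ _ (fun w => 3 * X1 k w ^+ 2)%R
  (fun w => 3 * X2 k w ^+ 2)%R); [|exact: Lfun1Z|exact: Lfun1Z].
rewrite !expectationZr// Ee.
apply: (@le_trans _ _ ((3 * (4 * M ^+ 2 * gamma))%:E * e%:E +
  (3%:E * (sigma ^+ 2 * (gamma / c ^+ 2) * e)%:E +
   3%:E * (sigma ^+ 2 * (gamma / c ^+ 2) * e)%:E))).
  by rewrite leeD2l// leeD// lee_pmul2l// lte_fin.
rewrite -!EFinM -!EFinD lee_fin.
have e0 : (0 <= e)%R.
  rewrite -lee_fin -Ee; exact: expectation_ge0.
have : (0 <= sigma ^+ 2 * (gamma / c ^+ 2) * e)%R.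
  by rewrite mulr_ge0// mulr_ge0 ?sqr_ge0// divr_ge0 ?sqr_ge0// ltW.
have -> : (12 * (gamma / c ^+ 2) * (sigma ^+ 2 + c ^+ 2 * M ^+ 2) * e =
  12 * (sigma ^+ 2 * (gamma / c ^+ 2) * e) + 12 * (M ^+ 2 * gamma * e))%R.
  by field.
have -> : (3 * (4 * M ^+ 2 * gamma) * e = 12 * (M ^+ 2 * gamma * e))%R by ring.
lra.
Qed.

End Replication.

(** * Assembly of the bias and variance bounds *)

Unset Implicit Arguments.

Theorem theorem3 (R : realType) :
  exists C : R, 0 < C /\
  forall (n : nat) (Z : 'cV[R]_n -> R) (L0 L1 L2 sigma : R)
    (d : measure_display) (Omega : measurableType d) (P : probability Omega R)
    (dT : nat -> measure_display) (T : forall k, measurableType (dT k))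
    (zeta : forall k, 'cV[R]_n -> T k -> R) (xi : forall k, Omega -> T k)
    (p : 'cV[R]_n) (c gamma : R) (N : nat)
    (delta : Omega -> 'cV[R]_n) (deltas : 'I_N -> Omega -> 'cV[R]_n),
  let Zhat k q w := zeta k q (xi k w) in
  let M1 := sup [set enorm (sgrad Z q) | q in simplex n] in
  let M2 := sup [set specnorm (shess Z q) | q in simplex n] in
  (2 <= n)%N ->
  sC 2 Z ->
  (forall q r, simplex n q -> simplex n r ->
     `|Z q - Z r| <= L0 * enorm (q - r)) ->
  (forall q r, simplex n q -> simplex n r ->
     enorm (sgrad Z q - sgrad Z r) <= L1 * enorm (q - r)) ->
  (forall q r, simplex n q -> simplex n r ->
     specnorm (shess Z q - shess Z r) <= L2 * enorm (q - r)) ->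
  0 < sigma ^+ 2 ->
  (forall k, noisy_evaluation P Z sigma (zeta k) (xi k)) ->
  simplex n p ->
  0 < c <= 1 ->
  (1 <= N)%N ->
  measurable_fun setT (delta : Omega -> borel_cV R n) ->
  (forall w, simplex n (delta w)) ->
  (forall j, measurable_fun setT (deltas j : Omega -> borel_cV R n)) ->
  (forall j w, simplex n (deltas j w)) ->
  (forall j, identically_distributed P
     (deltas j : Omega -> borel_cV R n) (delta : Omega -> borel_cV R n)) ->
  mutually_independent P (fun a : nat + 'I_N =>
    match a with
    | inl k => sigma_of (xi k)
    | inr j => sigma_of (deltas j : Omega -> borel_cV R n)
    end) ->
  has_mean P (fun w => Sffe gamma p (delta w)) 0 ->
  (exists lambda : R,
     has_mean P (fun w => (delta w - p) *m (Sffe gamma p (delta w))^T)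
       (1%:M - lambda *: (ones n *m (ones n)^T))) ->
  exists psi : 'cV[R]_n,
    [/\ has_mean P (psi_hat c gamma p Zhat deltas) psi,
        let eps0 := - (dot (sgrad Z p) (ones n) / n%:R) in
        enorm (psi - sgrad Z p - eps0 *: ones n)
          <= C * (n%:R * c * M2 + n%:R * c ^+ 2 * L2),
        ('E_P[fun w => (enorm (psi_hat c gamma p Zhat deltas w - psi) ^+ 2)%R]
          <= (C * (gamma * n%:R / (N%:R * c ^+ 2)
                * (sigma ^+ 2 + c ^+ 2 * M1 ^+ 2 + c ^+ 4 * L1 ^+ 2)))%:E)%E
      & forall mu : R,
          (forall i j k, ('E_P[fun w =>
             ((delta w - p) i 0 * (delta w - p) j 0
               * Sffe gamma p (delta w) k 0)%R] = mu%:E)%E) ->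
          let eps0 := c * mu / 2 * dot (ones n) (shess Z p *m ones n)
                      - dot (sgrad Z p) (ones n) / n%:R in
          enorm (psi - sgrad Z p - eps0 *: ones n)
            <= C * (n%:R * c ^+ 2 * L2)].
Proof.
(* The variance decides: 12 is 3 for the three squares times 4 for the squared distance bound. The
   two bias bounds hold with 2 and 4. *)
exists 12; split => //.
move=> n Z L0 L1 L2 sigma d Omega P dT T zeta xi p c gamma N delta deltas.
move=> Zhat M1 M2 n2 Z2 _ lip1 lip2 _ noisy sp c01 N1 mdelta sdelta.
move=> mdeltas sdeltas iddist indepE _ [lambda MC2].
have ZM1 q : simplex n q -> enorm (sgrad Z q) <= M1 by exact: sgrad_le_sup lip1.
have ZM2 q : simplex n q -> specnorm (shess Z q) <= M2 by exact: shess_le_sup lip2.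
have M10 : 0 <= M1 by exact: le_trans (enorm_ge0 _) (ZM1 p sp).
have M20 : 0 <= M2 by exact: le_trans (specnorm_ge0 _) (ZM2 p sp).
have L20 := shess_lipschitz_ge0 n2 lip2.
have /andP[c0 c1] := c01.
have c01' : 0 <= c <= 1 by rewrite ltW.
have g0 := gamma_gt0 n2 sp mdelta sdelta MC2.
have [cZ _] := Z2.
have nR0 : 0 < n%:R :> R by rewrite ltr0n (ltn_trans _ n2).
have NR0 : 0 < N%:R :> R by rewrite ltr0n.
have mxi m : measurable_fun setT (xi m) by case: (noisy m).
have indep1 j m : indep2 P (deltas j : Omega -> borel_cV R n) (xi m).
  move=> A B mA mB.
  have := @mutually_independent_seq _ _ _ P _ _ (inr j) [:: inr j; inl m]
    [:: deltas j @^-1` A; xi m @^-1` B] indepE isT erefl.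
  rewrite !big_cons !big_nil setIT mule1; apply=> -[|[|//]] _.
  - exact: (@sigma_of_preimage _ _ _ _ (deltas j : Omega -> borel_cV R n)).
  - exact: sigma_of_preimage.
have indep6 j k : j != k ->
    indep2 P (fun w => (deltas j w : borel_cV R n, xi j.*2 w, xi j.*2.+1 w))
      (fun w => (deltas k w : borel_cV R n, xi k.*2 w, xi k.*2.+1 w)).
  move=> jk; apply: indep2_triple => //.
  move=> A1 A2 A3 A4 A5 A6 mA1 mA2 mA3 mA4 mA5 mA6.
  have njk : (j : nat) <> k by move=> jk'; move/eqP: jk; apply; exact: val_inj.
  (* Replications [j] and [k] use the noises [2j, 2j+1] and [2k, 2k+1], which are distinct as [j]
     and [k] are. *)
  have us : uniq [:: inr j; inl j.*2; inl j.*2.+1; inr k; inl k.*2; inl k.*2.+1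
      : (nat + 'I_N)%type].
    rewrite /= !inE !negb_or !andbT.
    have e1 (a b : nat) : ((inl a : nat + 'I_N) == inl b) = (a == b) by [].
    have e2 (a b : 'I_N) : ((inr a : nat + 'I_N) == inr b) = (a == b) by [].
    rewrite !e1 !e2 jk/=.
    by repeat (apply/andP; split); apply/eqP => //; lia.
  have := @mutually_independent_seq _ _ _ P _ _ (inr j) _
    [:: deltas j @^-1` A1; xi j.*2 @^-1` A2; xi j.*2.+1 @^-1` A3;
        deltas k @^-1` A4; xi k.*2 @^-1` A5; xi k.*2.+1 @^-1` A6]
    indepE us erefl.
  rewrite !big_cons !big_nil setIT mule1 !setIA !muleA; apply.
  by move=> -[|[|[|[|[|[|//]]]]]] _; exact: sigma_of_preimage.
(* Defined through [delta] and the noise-free signal: the noises average out and all [deltas j]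
   share the law of [delta]. *)
pose psi : 'cV[R]_n :=
  \col_k fine 'E_P[fun w => ffe_signal (Z := Z) p c gamma k (delta w)].
have Lsignal k := Lfun1_ffe_signal P gamma Z2 ZM1 sp c01 mdelta sdelta k.
have Epsi k : ('E_P[fun w => ffe_signal (Z := Z) p c gamma k (delta w)] =
    (psi k 0)%:E)%E.
  by rewrite mxE fineK// expectation_fin_num.
pose V (j : 'I_N) k w := replication (Z := Z) (zeta j.*2) (zeta j.*2.+1) p c gamma k
  (deltas j w, xi j.*2 w, xi j.*2.+1 w).
have mV j k : measurable_fun setT (V j k).
  apply: measurableT_comp (measurable_replication gamma (noisy j.*2)
    (noisy j.*2.+1) Z2 sp c01 k) _.
  by apply: measurable_fun_pair => //; apply: measurable_fun_pair => //; exact: mdeltas.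
have EV j k : ('E_P[V j k] = (psi k 0)%:E)%E.
  rewrite (expectation_replication (noisy _) (noisy _) Z2 ZM1 sp c01 g0
    (mdeltas j) (sdeltas j) (indep1 j _) (indep1 j _)) -Epsi.
  exact: expectation_identically_distributed (mdeltas j) mdelta
    (measurable_ffe_signal gamma Z2 sp c01 k) (iddist j).
have psi_hatE w k : psi_hat c gamma p Zhat deltas w k 0 =
    N%:R^-1 * \sum_j V j k w.
  rewrite /psi_hat !mxE summxE; congr (_ * _); apply: eq_bigr => j _.
  by rewrite /V replicationE// !mxE.
pose K := 12 * (gamma / c ^+ 2) * (sigma ^+ 2 + c ^+ 2 * M1 ^+ 2).
have K0 : 0 <= K.
  apply: mulr_ge0; first by rewrite mulr_ge0// divr_ge0 ?sqr_ge0// ltW.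
  by rewrite -exprMn addr_ge0 ?sqr_ge0.
have V2 j k : ('E_P[fun w => (V j k w ^+ 2)%R] <= K%:E)%E.
  (* A diagonal entry of (MC2); its value [1 - 1 / n] is then bounded by 1. *)
  have Eh : ('E_P[fun w => (gamma * (deltas j w - p) k 0 * (deltas j w - p) k 0)%R]
      = (1 - lambda)%:E)%E.
    have := expectation_coordBM MC2 k k; rewrite eqxx => <-.
    apply: (@expectation_identically_distributed _ _ _ P _ _ _ _
      (fun x : borel_cV R n => gamma * (x - p) k 0 * (x - p) k 0)
      (mdeltas j) mdelta _ (iddist j)).
    by apply: measurable_funM; [apply: measurable_funM => //|];
      exact: measurable_coord_subr.
  apply: le_trans (expectation_replication_sqr_le (noisy _) (noisy _) Z2 ZM1 sp
    c01 g0 (mdeltas j) (sdeltas j) (indep1 j _) (indep1 j _) Eh) _.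
  rewrite lee_fin -/K; apply: ler_piMr; first exact: K0.
  by rewrite (lambdaE n2 sp mdelta sdelta MC2) gerBl invr_ge0 ltW.
have avg k : (fun w => (psi_hat c gamma p Zhat deltas w k 0 - psi k 0) ^+ 2)
      \in Lfun P 1 /\
    ('E_P[fun w => ((psi_hat c gamma p Zhat deltas w k 0 - psi k 0) ^+ 2)%R] <=
      (K / N%:R)%:E)%E.
  under eq_fun do rewrite psi_hatE.
  apply: average_variance_le => // j j' jj'.
  exact: (indep2_comp
    (measurable_replication gamma (noisy j.*2) (noisy j.*2.+1) Z2 sp c01 k)
    (measurable_replication gamma (noisy j'.*2) (noisy j'.*2.+1) Z2 sp c01 k)
    (indep6 j j' jj')).
pose r w := scaled_increment (Z := Z) p c (delta w) - dot (sgrad Z p) (delta w - p).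
have mr : measurable_fun setT r.
  apply: measurable_funB; last exact: measurable_dotB.
  exact: measurableT_comp (measurable_scaled_increment Z2 sp c01) mdelta.
have rE w : r w = (Z (p + c *: (delta w - p)) - Z p
    - c * dot (sgrad Z p) (delta w - p)) / c.
  by rewrite /r scaled_incrementE// mixE; field; rewrite gt_eqF.
have e2 w : enorm (delta w - p) <= 2 by exact: enorm_simplex_le2.
(* The remainder is quadratic in the distance; one power is bounded by 2 to reach the linear form
   that [enorm_expectation_le] takes. *)
have r_le w : `|r w| <= (c * M2 * 2) * enorm (delta w - p).
  rewrite rE normrM normfV (gtr0_norm c0) ler_pdivrMr//.
  rewrite (le_trans (taylor1_le Z2 sp (sdelta w) c01' ZM2))//.
  rewrite (_ : c * M2 * 2 * _ * c = c ^+ 2 * M2 * (2 * enorm (delta w - p))); last by ring.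
  apply: ler_wpM2l; first by rewrite mulr_ge0 ?sqr_ge0.
  by rewrite expr2 ler_wpM2r ?enorm_ge0.
have Lr k : (fun w => gamma * r w * (delta w - p) k 0) \in Lfun P 1.
  apply: (@Lfun1_bounded_coord _ _ _ P _ p gamma delta sp mdelta sdelta r
    (c * M2 * 2 * 2) k mr) => w.
  by rewrite (le_trans (r_le w))// ler_wpM2l ?mulr_ge0 ?(ltW c0).
(* The bias vector is exactly [E[r S]]: the mean of the subtracted linear part is
   [sgrad Z p + eps0 *: ones n]. *)
have Er k : ('E_P[fun w => (gamma * r w * (delta w - p) k 0)%R] =
    ((psi - sgrad Z p - (- (dot (sgrad Z p) (ones n) / n%:R)) *: ones n) k 0)%:E)%E.
  have Ld : (fun w => gamma * dot (sgrad Z p) (delta w - p) * (delta w - p) k 0)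
      \in Lfun P 1.
    apply: (@Lfun1_bounded_coord _ _ _ P _ p gamma delta sp mdelta sdelta _
      (enorm (sgrad Z p) * 2)); first exact: measurable_dotB.
    by move=> w; rewrite (le_trans (dot_le _ _))// ler_wpM2l ?enorm_ge0.
  rewrite (_ : (fun w => _) = (fun w => ffe_signal (Z := Z) p c gamma k (delta w)) \-
    (fun w => gamma * dot (sgrad Z p) (delta w - p) * (delta w - p) k 0)); last first.
    by apply/funext => w /=; rewrite /r /ffe_signal; ring.
  rewrite expectationB// Epsi (expectation_dotBM n2 sp mdelta sdelta MC2) -EFinB.
  by congr EFin; rewrite !mxE; ring.
exists psi; split.
- move=> k l; rewrite ord1.
  rewrite (_ : (fun w => _) = (fun w => N%:R^-1 * \sum_j V j k w)); last first.
    by apply/funext => w; exact: psi_hatE.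
  have LV j : V j k \in Lfun P 1.
    apply: Lfun1_sqr => //; apply: Lfun1_ge0 (V2 j k) => [|w].
      exact: measurable_funX.
    exact: sqr_ge0.
  rewrite expectationZr; last exact: Lfun1_sum.
  rewrite expectation_sumr//; under eq_bigr do rewrite EV.
  rewrite sumEFin -EFinM sumr_const card_ord; congr EFin.
  by rewrite -[X in _ * X]mulr_natl mulKf// gt_eqF.
- move=> eps0.
  have := enorm_expectation_le n2 sp mdelta sdelta MC2 mr _ r_le Er.
  rewrite !mulr_ge0 ?(ltW c0)// => /(_ isT) /le_trans; apply.
  have : 0 <= n%:R * c * M2 by rewrite !mulr_ge0 ?(ltW nR0) ?(ltW c0).
  have : 0 <= n%:R * c ^+ 2 * L2 by rewrite !mulr_ge0 ?exprn_ge0 ?(ltW nR0) ?(ltW c0).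
  rewrite (_ : n%:R * (c * M2 * 2) = 2 * (n%:R * c * M2)); last by ring.
  lra.
- rewrite (_ : (fun w => _) = (fun w => \sum_k
    (psi_hat c gamma p Zhat deltas w k 0 - psi k 0) ^+ 2)); last first.
    apply/funext => w; rewrite sqr_enorm dotE; apply: eq_bigr => k _.
    by rewrite !mxE -expr2.
  rewrite expectation_sumr; last by move=> k; case: (avg k).
  (* Each coordinate has variance at most [K / N]; summing them produces the factor [n]. *)
  apply: (@le_trans _ _ (\sum_(k < n) (K / N%:R)%:E)%E).
    by apply: lee_sum => k _; case: (avg k).
  rewrite sumEFin lee_fin sumr_const card_ord -[X in X <= _]mulr_natr.
  rewrite (_ : K / N%:R * n%:R = 12 * (gamma * n%:R / (N%:R * c ^+ 2) *
    (sigma ^+ 2 + c ^+ 2 * M1 ^+ 2))); last first.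
    by rewrite /K; field; rewrite !gt_eqF.
  apply: ler_wpM2l => //; apply: ler_wpM2l.
    by rewrite divr_ge0 ?mulr_ge0 ?exprn_ge0 ?(ltW nR0) ?(ltW NR0) ?(ltW c0) ?(ltW g0).
  by rewrite lerDl mulr_ge0 ?exprn_even_ge0.
- move=> mu MC3; cbv zeta.
  set eps0 := c * mu / 2 * _ - _.
  pose q w := dot (delta w - p) (shess Z p *m (delta w - p)).
  have mq : measurable_fun setT q by exact: measurable_quadB.
  pose s w := r w - c / 2 * q w.
  have ms : measurable_fun setT s.
    by apply: measurable_funB => //; exact: measurable_funM.
  (* Here the remainder is cubic, and two powers of the distance are bounded by [2 ^+ 2], whence the
     4. *)
  have s_le w : `|s w| <= (c ^+ 2 * L2 * 4) * enorm (delta w - p).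
    have -> : s w = (Z (p + c *: (delta w - p)) - Z p
        - c * dot (sgrad Z p) (delta w - p) - c ^+ 2 / 2 * q w) / c.
      by rewrite /s rE; field; rewrite gt_eqF.
    rewrite normrM normfV (gtr0_norm c0) ler_pdivrMr//.
    rewrite (le_trans (taylor2_le Z2 sp (sdelta w) c01' lip2))//.
    rewrite (_ : c ^+ 2 * L2 * 4 * _ * c =
      c ^+ 3 * L2 * (2 ^+ 2 * enorm (delta w - p))); last by ring.
    apply: ler_wpM2l; first by rewrite mulr_ge0 ?exprn_ge0 ?(ltW c0).
    by rewrite exprSr ler_wpM2r ?enorm_ge0// ler_pXn2r ?nnegrE ?enorm_ge0.
  have Lijk i j k : (fun w => (delta w - p) i 0 * (delta w - p) j 0 *
      Sffe gamma p (delta w) k 0) \in Lfun P 1.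
    have := @Lfun1_bounded_coord _ _ _ P _ p gamma delta sp mdelta sdelta
      (fun w => (delta w - p) i 0 * (delta w - p) j 0) (2 * 2) k.
    rewrite (_ : (fun w => gamma * _ * _) = (fun w => (delta w - p) i 0 *
      (delta w - p) j 0 * Sffe gamma p (delta w) k 0)); last first.
      by apply/funext => w; rewrite /Sffe !mxE; ring.
    apply; first by apply: measurable_funM; exact: measurable_coordB.
    by move=> w; rewrite normrM ler_pM// coordB_le2.
  (* Expanded into the third-order products of (MC3), whose common mean [mu] makes all coordinates
     of the quadratic term equal. *)
  have qE k : (fun w => gamma * q w * (delta w - p) k 0) = (fun w => \sum_i \sum_j
      shess Z p i j * ((delta w - p) i 0 * (delta w - p) j 0 *
        Sffe gamma p (delta w) k 0)).
    apply/funext => w; rewrite /q dotE mulr_sumr mulr_suml.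
    apply: eq_bigr => i _.
    have -> : (shess Z p *m (delta w - p)) i 0 =
        \sum_j shess Z p i j * (delta w - p) j 0 by rewrite mxE.
    rewrite !mulr_sumr mulr_suml; apply: eq_bigr => j _.
    have -> : Sffe gamma p (delta w) k 0 = gamma * (delta w - p) k 0.
      by rewrite mxE.
    by ring.
  have Lsum i k : (fun w => \sum_j shess Z p i j * ((delta w - p) i 0 *
      (delta w - p) j 0 * Sffe gamma p (delta w) k 0)) \in Lfun P 1.
    by apply: Lfun1_sum => j; exact: Lfun1Z.
  have Lq k : (fun w => gamma * q w * (delta w - p) k 0) \in Lfun P 1.
    by rewrite qE; apply: Lfun1_sum => i; exact: Lsum.
  have Eq k : ('E_P[fun w => (gamma * q w * (delta w - p) k 0)%R] =
      (mu * dot (ones n) (shess Z p *m ones n))%:E)%E.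
    rewrite qE expectation_sumr//.
    have Ei i : ('E_P[fun w => (\sum_j shess Z p i j * ((delta w - p) i 0 *
        (delta w - p) j 0 * Sffe gamma p (delta w) k 0))%R] =
        (\sum_j shess Z p i j * mu)%:E)%E.
      rewrite expectation_sumr; last by move=> j; exact: Lfun1Z.
      under eq_bigr do rewrite expectationZr// MC3 -EFinM.
      by rewrite sumEFin.
    under eq_bigr do rewrite Ei.
    rewrite sumEFin; congr EFin; rewrite dotE mulr_sumr; apply: eq_bigr => i _.
    rewrite [ones n i 0]mxE mul1r mxE mulr_sumr; apply: eq_bigr => j _.
    by rewrite [ones n j 0]mxE mulr1 mulrC.
  have Es k : ('E_P[fun w => (gamma * s w * (delta w - p) k 0)%R] =
      ((psi - sgrad Z p - eps0 *: ones n) k 0)%:E)%E.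
    rewrite (_ : (fun w => _) = (fun w => gamma * r w * (delta w - p) k 0) \-
      (fun w => c / 2 * (gamma * q w * (delta w - p) k 0))); last first.
      by apply/funext => w /=; rewrite /s; ring.
    rewrite expectationB//; last exact: Lfun1Z.
    rewrite Er expectationZr// Eq -EFinM -EFinB; congr EFin.
    by rewrite !mxE /eps0; ring.
  have := enorm_expectation_le n2 sp mdelta sdelta MC2 ms _ s_le Es.
  rewrite !mulr_ge0 ?exprn_ge0 ?(ltW c0)// => /(_ isT) /le_trans; apply.
  have : 0 <= n%:R * c ^+ 2 * L2 by rewrite !mulr_ge0 ?exprn_ge0 ?(ltW nR0) ?(ltW c0).
  rewrite (_ : n%:R * (c ^+ 2 * L2 * 4) = 4 * (n%:R * c ^+ 2 * L2)); last by ring.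
  lra.
Qed.
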